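(* If $\mathrm{P}=\mathrm{NP}$, then $\text{P-sel}=\text{A-P-sel}$, $\text{FP-sel}=\text{A-FP-sel}$, $\text{NP-sel}=\text{A-NP-sel}$, $\text{NPSV-sel}=\text{A-NPSV-sel}$, $\mathrm{NPMV}_t\text{-sel}=\text{A-}\mathrm{NPMV}_t\text{-sel}$, and $\text{NPMV-sel}=\text{A-NPMV-sel}$.
   Context: $\Sigma=\{0,1\}$. A 2-ary, possibly partial, possibly multivalued function $f$ assigns to each $(x,y)\in\Sigma^*\times\Sigma^*$ a set of values $\text{set-}f(x,y)\subseteq\Sigma^*$; $f(x,y)$ is undefined iff this set is empty; $f$ is total if it is never empty and single-valued if it always has at most one element. For sets $A$, $\text{set-}f(A,y)=\bigcup_{a\in A}\text{set-}f(a,y)$ and $\text{set-}f(y,A)=\bigcup_{a\in A}\text{set-}f(y,a)$. FP is the class of (possibly partial) single-valued functions computable in deterministic polynomial time; $\mathrm{FP}_t$ its total members. NPMV is the class of functions $f$ for which there is a nondeterministic polynomial-time Turing machine $M$ such that for all $x,y$ the set of strings output on accepting paths of $M(x,y)$ equals $\text{set-}f(x,y)$; NPSV is the class of single-valued functions in NPMV; $\mathrm{NPMV}_t$ and $\mathrm{NPSV}_t$ are the classes of total functions in NPMV and NPSV. For a function class $\mathcal F$, an $\mathcal F$-selector function for $B\subseteq\Sigma^*$ is an $f\in\mathcal F$ such that for all $x,y$: $\text{set-}f(x,y)\subseteq\{x,y\}$, and if $\{x,y\}\cap B\neq\emptyset$ then $\text{set-}f(x,y)\neq\emptyset$ and $\text{set-}f(x,y)\subseteq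 B$. $f$ is associative if $\text{set-}f(a,\text{set-}f(b,c))=\text{set-}f(\text{set-}f(a,b),c)$ for all $a,b,c\in\Sigma^*$. $\mathcal F$-sel is the class of sets having an $\mathcal F$-selector function, and A-$\mathcal F$-sel is the class of sets having an associative $\mathcal F$-selector function. P-sel, A-P-sel, NP-sel, A-NP-sel abbreviate $\mathrm{FP}_t$-sel, A-$\mathrm{FP}_t$-sel, $\mathrm{NPSV}_t$-sel, A-$\mathrm{NPSV}_t$-sel, respectively. *)

(* Defs.v *)
From HB Require Import structures.
From mathcomp Require Import all_boot ssralg poly.
From mathcomp Require Import boolp classical_sets.

Set Implicit Arguments.
Unset Strict Implicit.
Unset Printing Implicit Defensive.

Local Open Scope classical_set_scope.

Definition word := seq bool.

Inductive direction := MoveL | MoveN | MoveR.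

Definition code_direction (d : direction) : option bool :=
  match d with MoveL => Some false | MoveN => None | MoveR => Some true end.

Definition decode_direction (o : option bool) : direction :=
  match o with Some false => MoveL | None => MoveN | Some true => MoveR end.

Lemma code_directionK : cancel code_direction decode_direction.
Proof. by case. Qed.

HB.instance Definition _ := Finite.copy direction (can_type code_directionK).

(** [None] is the blank, [Some (inl b)] a binary symbol and [Some (inr g)] an
    auxiliary tape symbol of the machine. *)
Definition symbol (G : finType) : finType := option (bool + G)%type.

(** A two-way infinite tape [(l, r)]: [r] lists the cells from the head
    rightwards, [l] the cells to the left of the head, nearest first; all
    remaining cells are blank. *)
Definition tape (G : finType) : Type := (seq (symbol G) * seq (symbol G))%type.

Definition blank_tape (G : finType) : tape G := ([::], [::]).

Definition word_tape (G : finType) (w : word) : tape G :=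
  ([::], [seq Some (inl b) | b <- w]).

Definition read (G : finType) (t : tape G) : symbol G := head None t.2.

Definition write (G : finType) (s : symbol G) (t : tape G) : tape G :=
  (t.1, s :: behead t.2).

Definition move (G : finType) (d : direction) (t : tape G) : tape G :=
  match d with
  | MoveL => (behead t.1, head None t.1 :: t.2)
  | MoveN => t
  | MoveR => (head None t.2 :: t.1, behead t.2)
  end.

Fixpoint bits (G : finType) (s : seq (symbol G)) : word :=
  match s with
  | Some (inl b) :: s' => b :: bits s'
  | _ => [::]
  end.

(** A machine with [m] input words has tapes [inl i] (the [i]-th input tape),
    [inr None] (the output tape) and [inr (Some w)] (the work tapes); every tape
    may be read and written. *)
Record machine (m : nat) := Machine {
  aux : finType;
  work : finType;
  state : finType;
  start : state;
  accepting : {pred state};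
  delta : state -> {ffun 'I_m + option work -> symbol aux} ->
          {set state * {ffun 'I_m + option work -> symbol aux * direction}}
}.

Definition tape_index (m : nat) (M : machine m) : finType :=
  ('I_m + option (work M))%type.

Definition config (m : nat) (M : machine m) : Type :=
  (state M * {ffun tape_index M -> tape (aux M)})%type.

Definition initial (m : nat) (M : machine m) (x : m.-tuple word) : config M :=
  (start M, [ffun i : tape_index M => match i with
                                      | inl j => word_tape (aux M) (tnth x j)
                                      | inr _ => blank_tape (aux M)
                                      end]).

Definition scanned (m : nat) (M : machine m) (c : config M) :
    {ffun tape_index M -> symbol (aux M)} :=
  [ffun i => read (c.2 i)].

Definition moves (m : nat) (M : machine m) (c : config M) :=
  @delta m M c.1 (scanned c).

Definition step (m : nat) (M : machine m) (c d : config M) : Prop :=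
  exists2 a, a \in moves c
    & d = (a.1, [ffun i => move (a.2 i).2 (write (a.2 i).1 (c.2 i))]).

Fixpoint steps (m : nat) (M : machine m) (n : nat) (c d : config M) : Prop :=
  match n with
  | 0 => c = d
  | n'.+1 => exists2 e, step c e & steps n' e d
  end.

(** A path ends when no move is possible. *)
Definition accepting_end (m : nat) (M : machine m) (x : m.-tuple word)
    (c : config M) : Prop :=
  [/\ exists n, steps n (initial M x) c, moves c = finset.set0
    & c.1 \in @accepting m M].

Definition accepts (m : nat) (M : machine m) (x : m.-tuple word) : Prop :=
  exists c : config M, accepting_end x c.

(** The output of an accepting path is the longest binary string starting at the
    head of the output tape. *)
Definition outputs (m : nat) (M : machine m) (x : m.-tuple word) : set word :=
  [set z | exists2 c : config M, accepting_end x c & bits (c.2 (inr None)).2 = z].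

Definition deterministic (m : nat) (M : machine m) : Prop :=
  forall q s, #|@delta m M q s| <= 1.

(** Every computation path, accepting or not, is polynomially bounded. *)
Definition polytime (m : nat) (M : machine m) : Prop :=
  exists p : {poly nat}, forall (x : m.-tuple word) n (c : config M),
    steps n (initial M x) c -> n <= p.[sumn [seq size w | w <- x]]%R.

Definition decides (M : machine 1) (L : set word) : Prop :=
  forall x, L x <-> accepts M [tuple x].

Definition classP : set (set word) :=
  [set L | exists M : machine 1, [/\ deterministic M, polytime M & decides M L]].

Definition classNP : set (set word) :=
  [set L | exists M : machine 1, polytime M /\ decides M L].

Definition mvfun := word -> word -> set word.

Definition total_mv (f : mvfun) : Prop := forall x y, f x y !=set0.

Definition single_valued (f : mvfun) : Prop :=
  forall x y u v, f x y u -> f x y v -> u = v.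

Definition computes (M : machine 2) (f : mvfun) : Prop :=
  forall x y, outputs M [tuple x; y] = f x y.

Definition FP : set mvfun :=
  [set f | single_valued f /\
    exists M : machine 2, [/\ deterministic M, polytime M & computes M f]].

Definition NPMV : set mvfun :=
  [set f | exists M : machine 2, polytime M /\ computes M f].

Definition NPSV : set mvfun := NPMV `&` single_valued.

Definition FPt : set mvfun := FP `&` total_mv.
Definition NPMVt : set mvfun := NPMV `&` total_mv.
Definition NPSVt : set mvfun := NPSV `&` total_mv.

Definition selector (f : mvfun) (B : set word) : Prop :=
  forall x y, f x y `<=` [set x; y] /\
    ([set x; y] `&` B !=set0 -> f x y !=set0 /\ f x y `<=` B).

Definition associative_mv (f : mvfun) : Prop :=
  forall a b c,
    \bigcup_(u in f b c) f a u = \bigcup_(u in f a b) f u c.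

Definition sel (F : set mvfun) : set (set word) :=
  [set B | exists2 f, F f & selector f B].

Definition A_sel (F : set mvfun) : set (set word) :=
  [set B | exists f, [/\ F f, selector f B & associative_mv f]].

Definition P_sel := sel FPt.
Definition A_P_sel := A_sel FPt.
Definition NP_sel := sel NPSVt.
Definition A_NP_sel := A_sel NPSVt.

(* Main.v *)
Require Import Defs.
From mathcomp Require Import all_boot ssralg poly.
From mathcomp Require Import boolp classical_sets.

(** If P = NP, every set [B] with an NPMV selector [f] has an associative selector
    in FP_t, so that all the classes in question coincide.  Put
    [E u v := v \notin f(v, u) \/ u \in f(u, v)]: this relation is total, and
    [E u v] and [v \in B] imply [u \in B].  Among the words of length at most [n]
    let [x <=_n y] mean that [x] is in every [E]-predecessor-closed set containing
    [y].  A nonempty predecessor-closed set of a tournament consists of the points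
    reaching one of its "kings" in at most two steps, so [<=_n] is first-order
    definable and, when P = NP, decidable in polynomial time.  The total preorders
    [<=_n] become coarser as [n] grows; therefore comparing [x] and [y] by [<=_n]
    for [n = max(|x|, |y|)], ties being broken in favour of the shorter word, is
    transitive, and choosing the smaller word is an associative selector. *)

(** Bounding every quantifier by the longer of the two compared words keeps the guesses polynomial,
    but makes the preorder depend on the pair; this is why the levels have to be glued. On the
    machine side, every nondeterministic machine built has one form: a single left-to-right pass
    that may guess bits while it emits words, followed by a program run on the emitted words. All
    variables of the formula are coded in one word, so that an existential quantifier is a single
    guess on part of that word, and P = NP turns the resulting NP language back into one in P before
    the next negation or quantifier. The formula is fixed, so the polynomials grow only a constant
    number of times. The choice function must come from a deterministic machine; hence coding the
    two arguments and copying out the chosen one are programmed directly. *)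

Set Implicit Arguments.
Unset Strict Implicit.
Unset Printing Implicit Defensive.

Local Open Scope classical_set_scope.

(** * Kings and predecessor-closed sets *)

Section Kings.
Variable E : word -> word -> Prop.
Hypothesis E_refl : forall u, E u u.
Hypothesis E_total : forall u v, E u v \/ E v u.

(** Induct on the list. If [v] does not reach the king [k] of the tail in two steps, then no [w]
    with an edge to [k] receives an edge from [v], so by totality each such [w] has an edge to [v]:
    the paths into [k] can be redirected to [v]. *)
Lemma king_exists (s : seq word) : s != [::] ->
  exists2 k, k \in s &
    forall v, v \in s -> exists w, [/\ w \in s, E v w & E w k].
Proof.
elim: s => // v [|v' s'] IH _.
  exists v; rewrite ?mem_head // => z /[!inE]/eqP ->.
  by exists v; rewrite mem_head.
set s := v' :: s' in IH *.
have [k ks kP] := IH isT.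
have ins z : z \in s -> z \in v :: s by move=> zs; rewrite inE zs orbT.
have [[w [ws vw wk]]|Nv] :=
    pselect (exists w, [/\ w \in v :: s, E v w & E w k]).
  exists k; first exact: ins.
  move=> z /[1!inE]/orP[/eqP->|/kP[w' [? ? ?]]]; first by exists w.
  by exists w'; split=> //; apply: ins.
exists v; rewrite ?mem_head // => z /[1!inE]/orP[/eqP->|/kP[w [ws zw wk]]].
  by exists v; rewrite mem_head.
exists w; split=> //; first exact: ins.
have [//|vw] := E_total w v.
by case: Nv; exists w; split=> //; apply: ins.
Qed.

Fixpoint words_upto n : seq word :=
  if n is n'.+1 then
    let s := words_upto n' in [::] :: map (cons true) s ++ map (cons false) s
  else [:: [::]].

Lemma words_uptoP n (w : word) : (w \in words_upto n) = (size w <= n).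
Proof.
elim: n w => [|n IH] w; first by rewrite inE leqn0 size_eq0.
case: w => [|b w]; first by rewrite inE eqxx.
rewrite inE orFb mem_cat /= ltnS -IH.
apply/orP/idP => [[]/mapP[v vin [_ ->]] //|win].
by case: b; [left|right]; apply/mapP; exists w.
Qed.

Definition reaches2 n (k v : word) : Prop :=
  exists w, [/\ size w <= n, E v w & E w k].

Definition pred_closed n (C : word -> Prop) : Prop :=
  forall u v, size u <= n -> size v <= n -> E u v -> C v -> C u.

Definition leE n (x y : word) : Prop :=
  forall k, size k <= n -> pred_closed n (reaches2 n k) ->
    reaches2 n k y -> reaches2 n k x.

Lemma leE_trans n x y z : leE n x y -> leE n y z -> leE n x z.
Proof. by move=> xy yz k kn kC /(yz k kn kC)/(xy k kn kC). Qed.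

Lemma leE_total n x y : size x <= n -> size y <= n -> leE n x y \/ leE n y x.
Proof.
by move=> xn yn; have [xy|yx] := E_total x y; [left|right] => k _ kC; apply: kC.
Qed.

(* A predecessor-closed set is the set of points reaching one of its kings in
   two steps, so it is among the sets quantified over in [leE]. *)
Lemma leE_closed n C x y : pred_closed n C -> size x <= n -> size y <= n ->
  leE n x y -> C y -> C x.
Proof.
move=> Ccl xn yn xy Cy.
pose s := [seq w <- words_upto n | `[< C w >]].
have sP w : w \in s <-> size w <= n /\ C w.
  by rewrite mem_filter words_uptoP; split=> [/andP[/asboolP]|[wn Cw]] //;
     rewrite wn andbT; apply/asboolP.
have /king_exists[k /sP[kn Ck] kP] : s != [::].
  by have : y \in s by [apply/sP]; case: (s).
have CD v : size v <= n -> C v <-> reaches2 n k v.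
  move=> vn; split=> [Cv|[w [wn vw wk]]].
    by have [|w [/sP[wn _] vw wk]] := kP v; [apply/sP | exists w].
  exact: Ccl vw (Ccl w k wn kn wk Ck).
apply/CD => //; apply: xy => //; last exact/CD.
by move=> u v un vn uv /(CD v vn) Cv; apply/CD => //; apply: Ccl uv Cv.
Qed.

(** A set tested at level [n] is also closed at level [m], but need not be of the form
    [reaches2 m k]; this is where [leE_closed] is needed for arbitrary closed sets. *)
Lemma leE_coarsen m n x y : m <= n -> size x <= m -> size y <= m ->
  leE m x y -> leE n x y.
Proof.
move=> mn xm ym xy k kn kC; apply: (@leE_closed m) xy => // u v um vm.
by apply: kC; apply: leq_trans mn.
Qed.

(* Ties are broken by length: with this choice the preorders [leE n], which only
   become coarser as [n] grows, glue to a single one. *)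
Definition chooses (x y : word) : Prop :=
  let n := maxn (size x) (size y) in
  leE n x y /\ (~ leE n y x \/ size x <= size y).

Lemma chooses_total x y : chooses x y \/ chooses y x.
Proof.
rewrite /chooses [maxn (size y) _]maxnC; set n := maxn _ _.
have xn : size x <= n := leq_maxl _ _.
have yn : size y <= n := leq_maxr _ _.
have [xy|Nxy] := pselect (leE n x y); last first.
  by right; split; [case: (leE_total xn yn) | left].
have [yx|Nyx] := pselect (leE n y x); last by left; split=> //; left.
by have [?|/ltnW ?] := leqP (size x) (size y); [left|right]; split=> //; right.
Qed.

Lemma chooses_trans y x z : chooses x y -> chooses y z -> chooses x z.
Proof.
move=> xy yz; pose n := maxn (size y) (maxn (size x) (size z)).
have xn : size x <= n by rewrite !leq_max leqnn orbT.
have yn : size y <= n by rewrite leq_maxl.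
have zn : size z <= n by rewrite !leq_max leqnn !orbT.
have Lxy : leE n x y.
  by apply: leE_coarsen xy.1; rewrite ?geq_max ?xn ?leq_maxl ?leq_maxr.
have Lyz : leE n y z.
  by apply: leE_coarsen yz.1; rewrite ?geq_max ?yn ?leq_maxl ?leq_maxr.
have Lxz := leE_trans Lxy Lyz.
(* If [y] is not strictly the longest, [x] and [z] are compared at level [n]. Were the tie-break to
   fail, all three words would be equivalent there with [z] shorter than [x]; then [x] has length
   [n], the choice of [x] over [y] gives [y] length [n], and the choice of [y] over [z] makes [z] at
   least as long as [x]. *)
have [ym|my] := leqP (size y) (maxn (size x) (size z)).
  have nE : maxn (size x) (size z) = n by apply/esym/maxn_idPr.
  rewrite /chooses nE; split=> //.
  have [zx|] := pselect (leE n z x); last by left.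
  right; have [//|zx_lt] := leqP (size x) (size z).
  have xE : size x = n by rewrite -nE; apply/esym/maxn_idPl/ltnW.
  case: xy => _; rewrite (maxn_idPl _) ?xE // => -[/(_ (leE_trans Lyz zx))//|ny].
  case: yz => _; rewrite (maxn_idPl _); last first.
    by rewrite (leq_trans _ ny) // -xE ltnW.
  have yE : size y = n by apply/eqP; rewrite eqn_leq yn.
  rewrite yE => -[/(_ (leE_trans zx Lxy))//|].
  by rewrite -xE leqNgt zx_lt.
(* Now [y] is strictly the longest, so it was not chosen over [z] by a tie-break: the relation is
   strict at level [n]. Coarsening, read contrapositively, carries strictness from [n] down to
   [m]. *)
have nE : n = size y by apply/maxn_idPl/ltnW.
have zy : size z < size y by apply: leq_ltn_trans my; rewrite leq_maxr.
case: yz => _; rewrite (maxn_idPl (ltnW zy)) -nE => -[Nzy|]; last first.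
  by rewrite nE leqNgt zy.
rewrite /chooses; set m := maxn _ _ in my *.
have xm : size x <= m := leq_maxl _ _.
have zm : size z <= m := leq_maxr _ _.
have mn : m <= n by rewrite nE ltnW.
have Nzx : ~ leE m z x.
  move/(leE_coarsen mn zm xm) => zx; apply: Nzy.
  exact: leE_trans zx Lxy.
by split; [case: (leE_total xm zm) | left].
Qed.

End Kings.

(** * Choice by a total transitive relation *)

Definition choice_of (r : word -> word -> Prop) : mvfun :=
  fun x y => [set if `[< r x y >] then x else y]%classic.

(** Words related both ways are resolved in favour of the left argument, so both bracketings return
    the leftmost [r]-minimal word among [a], [b], [c]. *)
Lemma choice_of_assoc r : (forall x y, r x y \/ r y x) ->
  (forall y x z, r x y -> r y z -> r x z) -> associative_mv (choice_of r).
Proof.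
move=> rT rtr a b c; rewrite !bigcup_set1; congr ([set _]%classic).
have [bc|Nbc] := asboolP (r b c); have [ab|Nab] := asboolP (r a b) => //.
  by rewrite asboolT //; apply: rtr ab bc.
  by rewrite asboolT.
rewrite [in RHS]asboolF //; case: asboolP => // ac; case: Nab.
by case: (rT b c) => // /(rtr c a b ac).
Qed.

(** * Transition systems *)

Section TransitionSystems.
Variables (C : Type) (next : C -> C -> Prop).

Fixpoint nsteps n (c d : C) : Prop :=
  if n is n'.+1 then exists2 e, next c e & nsteps n' e d else c = d.

Definition stuck c := forall d, ~ next c d.

Definition ends c d := (exists n, nsteps n c d) /\ stuck d.

Definition within c N := forall n d, nsteps n c d -> n <= N.

Lemma within_next c N :
  (forall d, next c d -> within d N) -> within c N.+1.
Proof. by move=> cN [|n] // d [e /cN eN /eN]. Qed.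

Lemma within_stuck c N : stuck c -> within c N.
Proof. by move=> cS [|n] // d [e /cS]. Qed.

Lemma within_inv c N d : within c N -> next c d -> 0 < N /\ within d N.-1.
Proof.
move=> cN cd; have N0 : 0 < N by apply: (cN 1 d); exists d.
by split=> // n e de; rewrite -ltnS prednK //; apply: (cN n.+1 e); exists d.
Qed.

Lemma within_le c N N' : N <= N' -> within c N -> within c N'.
Proof. by move=> NN' cN n d /cN nN; apply: leq_trans NN'. Qed.

Lemma ends_stuck c d : stuck c -> ends c d <-> d = c.
Proof.
move=> cS; split=> [[[[|n]]]|->]; [by move=> <- | by case=> e /cS | ].
by split=> //; exists 0.
Qed.

Lemma ends_next c e d : next c d ->
  ends c e <-> exists2 d, next c d & ends d e.
Proof.
move=> cd; split=> [[[[|n] ce] eS]|[b cb [[n bn] eS]]].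
- by case: (eS d); rewrite -ce.
- by case: ce => b cb be; exists b => //; split=> //; exists n.
- by split=> //; exists n.+1, b.
Qed.

Lemma ends_next1 c d e : next c d -> (forall b, next c b -> b = d) ->
  ends c e <-> ends d e.
Proof.
move=> cd cd1; rewrite (ends_next e cd); split=> [[b /cd1->//]|de].
by exists d.
Qed.

Lemma ends_exists N c : within c N -> exists d, ends c d.
Proof.
elim: N c => [|N IH] c cN.
  by exists c; split; [exists 0 | move=> d /(within_inv cN)[]].
have [[d cd]|cS] := pselect (exists d, next c d).
  have [_ /IH[e de]] := within_inv cN cd.
  by exists e; apply/(ends_next _ cd); exists d.
by exists c; split; [exists 0 | move=> d cd; apply: cS; exists d].
Qed.

Hypothesis next_det : forall c d e, next c d -> next c e -> d = e.

Lemma ends_det c d e : ends c d -> ends c e -> d = e.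
Proof.
move=> [[n cd] dS]; elim: n c cd => [|n IH] c /=.
  by move=> -> /(ends_stuck e dS).
by move=> [b cb bd] /(ends_next e cb)[b' cb']; rewrite (next_det cb' cb); apply: IH.
Qed.

End TransitionSystems.

Section Simulation.
Variables (C C' : Type) (next : C -> C -> Prop) (next' : C' -> C' -> Prop).
Variable F : C -> C'.
(** Steps are reflected as well as preserved, so a run started in the image of [F] never leaves
    it. *)
Hypothesis simF : forall c d', next' (F c) d' <-> exists2 d, next c d & d' = F d.

Lemma sim_nsteps n c d' :
  nsteps next' n (F c) d' <-> exists2 d, nsteps next n c d & d' = F d.
Proof.
elim: n c d' => [|n IH] c d' /=.
  by split=> [<-|[d <- ->//]]; exists c.
split=> [[e' /simF[e ce ->] /IH[d ed ->]]|[d [e ce ed] ->]].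
  by exists d => //; exists e.
by exists (F e); [apply/simF; exists e | apply/IH; exists d].
Qed.

Lemma sim_within c N : within next' (F c) N <-> within next c N.
Proof.
split=> cN n d cd; first by apply: (cN n (F d)); apply/sim_nsteps; exists d.
by have /sim_nsteps[e ce _] := cd; apply: cN ce.
Qed.

Lemma sim_stuck c : stuck next' (F c) <-> stuck next c.
Proof.
split=> cS d cd; first by apply: (cS (F d)); apply/simF; exists d.
by have /simF[e /cS] := cd.
Qed.

Lemma sim_ends c d' :
  ends next' (F c) d' <-> exists2 d, ends next c d & d' = F d.
Proof.
split=> [[[n /sim_nsteps[d cd ->]] /sim_stuck dS]|[d [[n cd] dS] ->]].
  by exists d => //; split=> //; exists n.
split; last exact/sim_stuck.
by exists n; apply/sim_nsteps; exists d.
Qed.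

End Simulation.

Section Sequencing.
Variables (C C' : Type) (next : C -> C -> Prop) (next' : C' -> C' -> Prop).
Variables (F jump : C -> C').
(** The first phase runs in the image of [F]; where it gets stuck, one step enters the second phase.
    That step is the extra unit in [seq_within]. *)
Hypothesis seqF : forall c d', next' (F c) d' <->
  (exists2 d, next c d & d' = F d) \/ (stuck next c /\ d' = jump c).

Lemma seq_within c N N' : within next c N ->
  (forall d, ends next c d -> within next' (jump d) N') ->
  within next' (F c) (N + N'.+1).
Proof.
elim: N c => [|N IH] c cN cN'.
  have cS : stuck next c by move=> d /(within_inv cN)[].
  apply: within_next => d' /seqF[[d /cS//]|[_ ->]].
  by apply: cN'; apply/(ends_stuck _ cS).
rewrite addSn; apply: within_next => d' /seqF[[d cd ->]|[cS ->]].
  have [_ dN] := within_inv cN cd.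
  by apply: IH => // e de; apply: cN'; apply/(ends_next _ cd); exists d.
apply: (@within_le _ _ _ N'); first by rewrite addnS ltnW // ltnS leq_addl.
by apply: cN'; apply/(ends_stuck _ cS).
Qed.

Lemma seq_ends c e :
  ends next' (F c) e <-> exists2 d, ends next c d & ends next' (jump d) e.
Proof.
split=> [[[n cn] eS]|[d [[n cd] dS] de]].
  elim: n c cn => [|n IH] c /=.
    move=> ce; case: (pselect (stuck next c)) => [cS|].
      by case: (eS (jump c)); rewrite -ce; apply/seqF; right.
    case=> d cd; case: (eS (F d)); rewrite -ce; apply/seqF; left.
    by exists d.
  move=> [b' /seqF[[b cb ->] /IH[d bd de]|[cS ->] je]].
    by exists d => //; apply/(ends_next _ cb); exists b.
  exists c; first exact/ends_stuck.
  by split=> //; exists n.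
elim: n c cd => [|n IH] c /= => [->|[b cb /IH bd]].
  have dj : next' (F d) (jump d) by apply/seqF; right.
  by apply/(ends_next _ dj); exists (jump d).
have cb' : next' (F c) (F b) by apply/seqF; left; exists b.
by apply/(ends_next _ cb'); exists (F b).
Qed.

End Sequencing.

(** * Programs over a fixed set of tapes *)

Section Tapes.
Variable G : finType.

(* Cells to the left of the head (nearest first), and from the head rightwards;
   unlike [tape], this does not distinguish tapes up to trailing blanks, so that
   rewriting the scanned symbol in place does nothing. *)
Definition atape : Type := ((nat -> symbol G) * (nat -> symbol G))%type.

Definition cells (t : tape G) : atape := (nth None t.1, nth None t.2).

Definition consf (s : symbol G) (f : nat -> symbol G) n : symbol G :=
  if n is n'.+1 then f n' else s.

Definition act (a : symbol G * direction) (t : atape) : atape :=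
  let r := fun n => t.2 n.+1 in
  match a.2 with
  | MoveL => (fun n => t.1 n.+1, consf (t.1 0) (consf a.1 r))
  | MoveN => (t.1, consf a.1 r)
  | MoveR => (consf a.1 t.1, r)
  end.

Lemma cells_act a t : cells (move a.2 (write a.1 t)) = act a (cells t).
Proof.
case: a t => s [] [l r]; rewrite /cells /act /=; congr pair; apply/funext.
- by move=> n; rewrite nth_behead.
- by case: l => [|x l] [|[|n]] //=; rewrite nth_behead.
- by case=> [|n] //=; rewrite nth_behead.
- by case.
- by move=> n; rewrite nth_behead.
Qed.

Lemma act_id t : act (t.2 0, MoveN) t = t.
Proof. by case: t => l r; congr pair; apply/funext; case. Qed.

End Tapes.

Section Programs.
Variables I G : finType.

(** A machine whose tapes are indexed by an arbitrary finite type, so that tapes and symbols can be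
    added when programs are combined. *)
Record program := Program {
  pstate : finType;
  pstart : pstate;
  paccept : {pred pstate};
  pdelta : pstate -> {ffun I -> symbol G} ->
           {set pstate * {ffun I -> symbol G * direction}}
}.

Arguments pstart : clear implicits.
Arguments paccept : clear implicits.

Definition tapes := I -> atape G.

Definition scan (t : tapes) : {ffun I -> symbol G} := [ffun i => (t i).2 0].

Definition acts (a : {ffun I -> symbol G * direction}) (t : tapes) : tapes :=
  fun i => act (a i) (t i).

Definition pconfig (P : program) : Type := (pstate P * tapes)%type.

Definition pnext (P : program) (c d : pconfig P) : Prop :=
  exists2 a, a \in pdelta c.1 (scan c.2) & d = (a.1, acts a.2 c.2).

Definition pdet (P : program) := forall q s, #|pdelta (p := P) q s| <= 1.

Definition pends (P : program) (t : tapes) := ends (@pnext P) (pstart P, t).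

Arguments pends : clear implicits.

Definition pwithin (P : program) (t : tapes) := within (@pnext P) (pstart P, t).

Definition yields (P : program) (t : tapes) b (t' : tapes) :=
  exists2 d, pends P t d & (d.1 \in paccept P) = b /\ d.2 = t'.

Definition paccepts (P : program) t := exists t', yields P t true t'.

Lemma pstuckP (P : program) (c : pconfig P) :
  stuck (@pnext P) c <-> pdelta c.1 (scan c.2) = finset.set0.
Proof.
split=> [cS|c0 d [a]]; last by rewrite c0 inE.
by apply/setP => a; rewrite inE; apply/negP => ac; apply: cS; exists a.
Qed.

Lemma pnext_det (P : program) : pdet P ->
  forall c d e : pconfig P, pnext c d -> pnext c e -> d = e.
Proof.
move=> Pdet c d e [a ac ->] [b bc ->].
by have /card_le1_eqP/(_ a b ac bc)-> := Pdet c.1 (scan c.2).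
Qed.

Lemma acts_id (t : tapes) : acts [ffun i => (scan t i, MoveN)] t = t.
Proof. by apply/funext => i; rewrite /acts !ffunE act_id. Qed.

Definition halt b : program :=
  @Program unit tt [pred _ | b] (fun _ _ => finset.set0).

Lemma halt_stuck b (c : pconfig (halt b)) : stuck (@pnext (halt b)) c.
Proof. exact/pstuckP. Qed.

Lemma halt_yields b t b' t' : yields (halt b) t b' t' <-> b' = b /\ t' = t.
Proof.
split=> [[d /(ends_stuck _ (@halt_stuck _ _))-> [<- <-]]|[-> ->]]; first by [].
by exists (tt, t) => //; apply/(ends_stuck _ (@halt_stuck _ _)).
Qed.

Lemma halt_within b t N : pwithin (halt b) t N.
Proof. exact/within_stuck/halt_stuck. Qed.

Lemma halt_det b : pdet (halt b).
Proof. by move=> q s; rewrite cards0. Qed.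

(** * Branching and sequential composition *)

Section Conditional.
Variables P P1 P2 : program.

Definition cond_state : finType := (pstate P + (pstate P1 + pstate P2))%type.

Definition cond_accept : {pred cond_state} := fun q => match q with
  | inl _ => false
  | inr (inl q) => q \in paccept P1
  | inr (inr q) => q \in paccept P2
  end.

Definition cond_jump (q : pstate P) : cond_state :=
  inr (if q \in paccept P then inl (pstart P1) else inr (pstart P2)).

(** The branches inherit the tapes left by the condition: the jump rewrites the scanned symbols in
    place, which is the identity on [atape]. *)
Definition cond_delta (q : cond_state) (s : {ffun I -> symbol G}) :
    {set cond_state * {ffun I -> symbol G * direction}} :=
  match q with
  | inl q =>
      if pdelta q s == finset.set0 then
        [set (cond_jump q, [ffun i => (s i, MoveN)])]%SET
      else [set (inl a.1, a.2) | a in pdelta q s]%SET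
  | inr (inl q) => [set (inr (inl a.1), a.2) | a in pdelta q s]%SET
  | inr (inr q) => [set (inr (inr a.1), a.2) | a in pdelta q s]%SET
  end.

Definition cond := Program (inl (pstart P)) cond_accept cond_delta.

Lemma cond_det : pdet P -> pdet P1 -> pdet P2 -> pdet cond.
Proof.
move=> D D1 D2 [q|[q|q]] s /=; try exact: leq_trans (leq_imset_card _ _) _.
by case: ifP => _; rewrite ?cards1 //; apply: leq_trans (leq_imset_card _ _) _.
Qed.

Let F0 (c : pconfig P) : pconfig cond := (inl c.1, c.2).
Let F1 (c : pconfig P1) : pconfig cond := (inr (inl c.1), c.2).
Let F2 (c : pconfig P2) : pconfig cond := (inr (inr c.1), c.2).

Lemma cond_sim1 c d' :
  pnext (F1 c) d' <-> exists2 d, pnext c d & d' = F1 d.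
Proof.
split=> [[_ /imsetP[a ac ->] ->]|[d [a ac ->] ->]].
  by exists (a.1, acts a.2 c.2) => //; exists a.
by exists (inr (inl a.1), a.2) => //; apply/imsetP; exists a.
Qed.

Lemma cond_sim2 c d' :
  pnext (F2 c) d' <-> exists2 d, pnext c d & d' = F2 d.
Proof.
split=> [[_ /imsetP[a ac ->] ->]|[d [a ac ->] ->]].
  by exists (a.1, acts a.2 c.2) => //; exists a.
by exists (inr (inr a.1), a.2) => //; apply/imsetP; exists a.
Qed.

Lemma cond_seq c d' : pnext (F0 c) d' <->
  (exists2 d, pnext c d & d' = F0 d) \/
  (stuck (@pnext P) c /\ d' = (cond_jump c.1, c.2)).
Proof.
split=> [[a]|] /=.
  case: eqP => [c0 /set1P-> -> /=|_ /imsetP[b bc ->] ->]; last first.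
    by left; exists (b.1, acts b.2 c.2) => //; exists b.
  by right; rewrite acts_id; split=> //; apply/pstuckP.
case=> [[d [a ac ->] ->]|[/pstuckP c0 ->]].
  exists (inl a.1, a.2) => //=; case: eqP => [c0|_].
    by rewrite c0 inE in ac.
  by apply/imsetP; exists a.
exists (cond_jump c.1, [ffun i => (scan c.2 i, MoveN)]) => /=.
  by rewrite c0 eqxx inE.
by rewrite acts_id.
Qed.

Lemma cond_within t N N' : pwithin P t N ->
  (forall t', yields P t true t' -> pwithin P1 t' N') ->
  (forall t', yields P t false t' -> pwithin P2 t' N') ->
  pwithin cond t (N + N'.+1).
Proof.
move=> PN H1 H2; apply: (seq_within cond_seq (c := (_, _)) PN) => -[q t'] td.
rewrite /cond_jump /=; case: ifP => qA.
  by apply/(sim_within cond_sim1 (_, _)); apply: H1; exists (q, t').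
by apply/(sim_within cond_sim2 (_, _)); apply: H2; exists (q, t').
Qed.

Lemma cond_yields t b t'' : yields cond t b t'' <-> exists t',
  (yields P t true t' /\ yields P1 t' b t'') \/
  (yields P t false t' /\ yields P2 t' b t'').
Proof.
split=> [[e /(seq_ends cond_seq (_, _))[[q t'] td je] [eb et]]|[t' H]].
  exists t'; move: je; rewrite /cond_jump /=; case: ifP => qA je; [left|right].
    split; first by exists (q, t').
    have /(sim_ends cond_sim1 (_, _))[d Hd ed] := je.
    by exists d => //; rewrite ed in eb et.
  split; first by exists (q, t').
  have /(sim_ends cond_sim2 (_, _))[d Hd ed] := je.
  by exists d => //; rewrite ed in eb et.
case: H => -[[[q u] td /= [qA <-]] [e te [eA <-]]].
  exists (F1 e) => //; apply/(seq_ends cond_seq (_, _)); exists (q, u) => //.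
  by rewrite /cond_jump qA; apply/(sim_ends cond_sim1 (_, _)); exists e.
exists (F2 e) => //; apply/(seq_ends cond_seq (_, _)); exists (q, u) => //.
by rewrite /cond_jump qA; apply/(sim_ends cond_sim2 (_, _)); exists e.
Qed.

End Conditional.

(** Rejecting paths of [P] are sent to [halt false], so only its accepting paths continue with
    [P1]. *)
Definition seqp P P1 := cond P P1 (halt false).

Lemma seqp_yields P P1 t t'' : yields (seqp P P1) t true t'' <->
  exists2 t', yields P t true t' & yields P1 t' true t''.
Proof.
split=> [/cond_yields[t' [[? ?]|[_ /halt_yields[]]]] //|[t' ? ?]].
  by exists t'.
by apply/cond_yields; exists t'; left.
Qed.

Lemma seqp_within P P1 t N N' : pwithin P t N ->
  (forall t', yields P t true t' -> pwithin P1 t' N') ->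
  pwithin (seqp P P1) t (N + N'.+1).
Proof. by move=> ? ?; apply: cond_within => // *; apply: halt_within. Qed.

End Programs.

Arguments pstate {I G} p.
Arguments pstart {I G} p.
Arguments paccept {I G} p.
Arguments pends {I G} P t.

(** * Running a program on some tapes of a larger family *)

Section Lifting.
Variables (J I H G : finType) (P : program J H).
Variables (e : J -> I) (e' : I -> option J) (h : H -> G) (h' : G -> option H).
Hypotheses (eK : pcancel e e') (e'K : ocancel e' e) (hK : pcancel h h').

Definition hsym (s : symbol H) : symbol G :=
  match s with
  | Some (inr g) => Some (inr (h g))
  | Some (inl b) => Some (inl b)
  | None => None
  end.

(** Symbols outside the range of [hsym] read as blank; the tapes that [overlay] hands to [P] contain
    none of them. *)
Definition usym (s : symbol G) : symbol H :=
  match s with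
  | Some (inr g) => if h' g is Some g' then Some (inr g') else None
  | Some (inl b) => Some (inl b)
  | None => None
  end.

Lemma hsymK : cancel hsym usym.
Proof. by case=> [[b|g]|] //=; rewrite hK. Qed.

Definition htape (t : atape H) : atape G := (hsym \o t.1, hsym \o t.2).

Definition overlay (t : tapes I G) (s : tapes J H) : tapes I G :=
  fun i => if e' i is Some j then htape (s j) else t i.

Definition embed_move (a : {ffun J -> symbol H * direction})
    (s : {ffun I -> symbol G}) : {ffun I -> symbol G * direction} :=
  [ffun i => if e' i is Some j then (hsym (a j).1, (a j).2) else (s i, MoveN)].

Definition embed_delta (q : pstate P) (s : {ffun I -> symbol G}) :
    {set pstate P * {ffun I -> symbol G * direction}} :=
  [set (a.1, embed_move a.2 s) | a in pdelta q [ffun j => usym (s (e j))]]%SET.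

Definition embed := Program (pstart P) (paccept P) embed_delta.

Lemma embed_det : pdet P -> pdet embed.
Proof. by move=> D q s; apply: leq_trans (leq_imset_card _ _) _. Qed.

Lemma htape_act a t : htape (act a t) = act (hsym a.1, a.2) (htape t).
Proof.
by case: a => s []; rewrite /htape /act /=; congr pair; apply/funext => -[|[|n]].
Qed.

Section Sim.
Variable t : tapes I G.
Let F (c : pconfig P) : pconfig embed := (c.1, overlay t c.2).

Lemma embed_sim c d' : pnext (F c) d' <-> exists2 d, pnext c d & d' = F d.
Proof.
have scanE : [ffun j => usym (scan (overlay t c.2) (e j))] = scan c.2.
  by apply/ffunP => j; rewrite !ffunE /overlay eK /= hsymK.
have actE a : acts (embed_move a (scan (overlay t c.2))) (overlay t c.2) =
    overlay t (acts a c.2).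
  apply/funext => i; rewrite /acts !ffunE /overlay.
  by case: (e' i) => [j|]; rewrite ?htape_act // act_id.
split=> [[_ /imsetP[a + ->] ->]|[d [a ac ->] ->]].
  rewrite /= scanE => ac; exists (a.1, acts a.2 c.2); first by exists a.
  by rewrite actE.
eexists; first by apply/imsetP; exists a; [rewrite scanE | reflexivity].
by rewrite /= actE.
Qed.

Lemma embed_within s N : pwithin P s N -> pwithin embed (overlay t s) N.
Proof. by move/(sim_within embed_sim). Qed.

Lemma embed_yields s b t' : yields embed (overlay t s) b t' <->
  exists2 s', yields P s b s' & t' = overlay t s'.
Proof.
split=> [[d' /(sim_ends embed_sim (_, _))[d sd ->] [<- <-]]|].
  by exists d.2 => //; exists d.
move=> [s' [d sd [db ds]] ->].
by exists (F d); [apply/(sim_ends embed_sim (_, _)); exists d | rewrite /= ds].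
Qed.
End Sim.

Lemma overlayE t s : (forall j, t (e j) = htape (s j)) -> overlay t s = t.
Proof.
move=> ts; apply/funext => i; rewrite /overlay.
by have := e'K i; case: (e' i) => [j /= <-|].
Qed.

End Lifting.

(** * Programs as machines *)

Definition poly_bounded (b : nat -> nat) : Prop :=
  exists p : {poly nat}, forall n, b n <= p.[n]%R.

Lemma horner_nat_le (p : {poly nat}) m n : m <= n -> (p.[m] <= p.[n])%R.
Proof.
move=> mn; rewrite !horner_coef; apply: leq_sum => i _.
rewrite natrME leq_mul2l !natrXE; apply/orP; right.
by case: (val i) => // e; rewrite leq_exp2r.
Qed.

Lemma poly_bounded_id : poly_bounded id.
Proof. by exists 'X%R => n; rewrite hornerX. Qed.

Lemma poly_bounded_cst c : poly_bounded (fun=> c).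
Proof. by exists c%:P%R => n; rewrite hornerC. Qed.

Lemma poly_bounded_add b b' : poly_bounded b -> poly_bounded b' ->
  poly_bounded (fun n => b n + b' n).
Proof.
by move=> [p bp] [q bq]; exists (p + q)%R => n; rewrite hornerD leq_add.
Qed.

Lemma poly_bounded_comp b b' : poly_bounded b -> poly_bounded b' ->
  poly_bounded (fun n => b (b' n)).
Proof.
move=> [p bp] [q bq]; exists (p \Po q)%R => n.
by rewrite horner_comp; apply: leq_trans (bp _) (horner_nat_le _ (bq n)).
Qed.

Lemma poly_bounded_affine c d b : poly_bounded b ->
  poly_bounded (fun n => c * b n + d).
Proof.
move=> bP; apply: poly_bounded_add; last exact: poly_bounded_cst.
elim: c => [|c IH]; first exact: poly_bounded_cst.
by under eq_fun do rewrite mulSn; apply: poly_bounded_add.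
Qed.

Section Machines.
Variable m : nat.

Definition wtape (G : finType) (w : word) : atape G := cells (word_tape G w).

Definition btape (G : finType) : atape G := cells (blank_tape G).

Definition input (W G : finType) (x : m.-tuple word) :
    tapes ('I_m + option W)%type G :=
  fun i => if i is inl j then wtape G (tnth x j) else btape G.

Arguments input {W G} x _.

Definition program_of (M : machine m) : program (tape_index M) (aux M) :=
  Program (start M) (@accepting m M) (@delta m M).

Definition machine_of (W G : finType)
    (P : program ('I_m + option W)%type G) : machine m :=
  @Machine m G W (pstate P) (pstart P) (paccept P) (@pdelta _ _ P).

Lemma machine_ofK (W G : finType) (P : program ('I_m + option W)%type G) :
  program_of (machine_of P) = P.
Proof. by case: P. Qed.

Definition tobit (G : finType) (s : symbol G) : option bool :=
  if s is Some (inl b) then Some b else None.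

(** Tapes given as functions are infinite, so [bits] cannot recurse on them; its value is described
    by recursion on the word instead. *)
Fixpoint spells (G : finType) (z : word) (g : nat -> symbol G) : Prop :=
  if z is b :: z' then tobit (g 0) = Some b /\ spells z' (fun n => g n.+1)
  else tobit (g 0) = None.

Lemma spells_bits (G : finType) z (r : seq (symbol G)) :
  spells z (nth None r) <-> bits r = z.
Proof.
elim: r z => [|[[c|g]|] r IH] [|b z] //=; try by split=> // -[].
by rewrite IH; split=> [[[->] ->]|[-> ->]].
Qed.

Section FixedMachine.
Variable M : machine m.

Let abs (c : config M) : pconfig (program_of M) :=
  (c.1, fun i => cells (c.2 i)).

Lemma scan_abs c : scan (abs c).2 = scanned c.
Proof. by apply/ffunP => i; rewrite !ffunE /= nth0. Qed.

Lemma abs_sim c d' : pnext (abs c) d' <-> exists2 d, step c d & d' = abs d.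
Proof.
have actsE a : acts a (abs c).2 =
    fun i => cells ([ffun i => move (a i).2 (write (a i).1 (c.2 i))] i).
  by apply/funext => i; rewrite /acts ffunE cells_act.
split=> [[a ac ->]|[_ [a ac ->] ->]].
  rewrite actsE; rewrite scan_abs in ac.
  by exists (a.1, [ffun i => move (a.2 i).2 (write (a.2 i).1 (c.2 i))]) => //; exists a.
by exists a; rewrite ?scan_abs ?actsE.
Qed.

Lemma steps_nsteps n (c d : config M) : steps n c d <-> nsteps (@step m M) n c d.
Proof.
elim: n c => //= n IH c.
by split=> -[e ce /IH ed]; exists e.
Qed.

Lemma stuck_moves (c : config M) : stuck (@step m M) c <-> moves c = finset.set0.
Proof.
by rewrite -(sim_stuck abs_sim) pstuckP scan_abs.
Qed.

Lemma abs_initial x : abs (initial M x) = (pstart (program_of M), input x).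
Proof.
by congr pair; apply/funext => -[j|[w|]]; rewrite /= ffunE.
Qed.

Lemma accepting_endP x t' : yields (program_of M) (input x) true t' <->
  exists2 c, accepting_end x c & (fun i => cells (c.2 i)) = t'.
Proof.
rewrite /yields /pends -abs_initial; split.
  move=> [d' /(sim_ends abs_sim)[c [[n xc] cS] ->] [cA ct]]; exists c => //.
  by split=> //; [exists n; apply/steps_nsteps | apply/stuck_moves].
move=> [c [[n /steps_nsteps xc] /stuck_moves cS cA] ct].
exists (abs c) => //; apply/(sim_ends abs_sim); exists c => //.
by split=> //; exists n.
Qed.

Lemma acceptsP x : accepts M x <-> paccepts (program_of M) (input x).
Proof.
split=> [[c cA]|[t' /accepting_endP[c]]]; last by exists c.
by eexists; apply/accepting_endP; exists c.
Qed.

Lemma outputsP x z : outputs M x z <->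
  exists2 t', yields (program_of M) (input x) true t' &
    spells z (t' (inr None)).2.
Proof.
split=> [[c cA cz]|[t' /accepting_endP[c cA <-] cz]].
  exists (fun i => cells (c.2 i)); first by apply/accepting_endP; exists c.
  exact/(spells_bits z (c.2 _).2).
by exists c => //; apply/(spells_bits z (c.2 _).2).
Qed.

Lemma withinP x N : pwithin (program_of M) (input x) N <->
  forall n c, steps n (initial M x) c -> n <= N.
Proof.
rewrite /pwithin -abs_initial (sim_within abs_sim).
by split=> H n c /steps_nsteps; apply: H.
Qed.

End FixedMachine.
End Machines.

Arguments input {m W G} x _.

Lemma tuple1E (T : Type) (x : 1.-tuple T) : exists a, x = [tuple a].
Proof. by case: x => [[|a []]] //= ?; exists a; apply: val_inj. Qed.

Lemma tuple2E (T : Type) (x : 2.-tuple T) : exists a b, x = [tuple a; b].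
Proof. by case: x => [[|a [|b []]]] //= ?; exists a, b; apply: val_inj. Qed.

Lemma polytime_program1 (W G : finType) (P : program ('I_1 + option W)%type G)
    b : poly_bounded b -> (forall x, pwithin P (input [tuple x]) (b (size x))) ->
  polytime (machine_of P).
Proof.
move=> [p bp] Pb; exists p => x; have [w ->] := tuple1E x.
rewrite /= addn0; apply/(@withinP _ (machine_of P)); rewrite machine_ofK.
exact: within_le (Pb w).
Qed.

Lemma classNP_program (W G : finType) (P : program ('I_1 + option W)%type G)
    b (L : set word) :
  poly_bounded b -> (forall x, pwithin P (input [tuple x]) (b (size x))) ->
  (forall x, L x <-> paccepts P (input [tuple x])) -> classNP L.
Proof.
move=> bP Pb PL; exists (machine_of P); split.
  exact: polytime_program1 bP Pb.
by move=> x; rewrite PL acceptsP machine_ofK.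
Qed.

(** The bound is kept monotone because the program is later run on a word whose length is only
    estimated from above. *)
Definition decider (W G : finType) (P : program ('I_1 + option W)%type G)
    (b : nat -> nat) (L : set word) : Prop :=
  [/\ pdet P, {homo b : m n / m <= n}, poly_bounded b,
      forall x, pwithin P (input [tuple x]) (b (size x)) &
      forall x, L x <-> paccepts P (input [tuple x])].

Lemma classP_decider (L : set word) : classP L ->
  exists (W G : finType) (P : program ('I_1 + option W)%type G) b, decider P b L.
Proof.
move=> [M [Mdet [p Mp] ML]].
exists (work M), (aux M), (program_of M), (fun n => p.[n]%R); split => //.
- by move=> m n; apply: horner_nat_le.
- by exists p.
- by move=> x; apply/withinP => n c /Mp; rewrite /= addn0.
- by move=> x; rewrite ML acceptsP.
Qed.

Lemma decider_classP (W G : finType) (P : program ('I_1 + option W)%type G) b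
  (L : set word) : decider P b L -> classP L.
Proof.
move=> [Pdet _ bP Pb PL]; exists (machine_of P); split=> //.
  exact: polytime_program1 bP Pb.
by move=> x; rewrite PL acceptsP machine_ofK.
Qed.

Lemma yields_det (I G : finType) (P : program I G) t b b' t' t'' : pdet P ->
  yields P t b t' -> yields P t b' t'' -> b = b' /\ t' = t''.
Proof.
move=> Pdet [d td [<- <-]] [e te [<- <-]].
by rewrite (ends_det (pnext_det Pdet) td te).
Qed.

Lemma yields_exists (I G : finType) (P : program I G) t N : pwithin P t N ->
  exists b t', yields P t b t'.
Proof.
move=> PN; have [d td] := ends_exists PN.
by exists (d.1 \in paccept P), d.2, d.
Qed.

Lemma classP_setC (L : set word) : classP L -> classP (~` L).
Proof.
move=> /classP_decider[W [G [P [b [Pdet bm bP Pb PL]]]]].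
pose P' := Program (pstart P) [pred q | q \notin paccept P] (@pdelta _ _ P).
have yP' t c t' : yields P' t c t' <-> yields P t (~~ c) t'.
  split=> -[d td [dA dt]]; exists d => //; split=> //.
    by rewrite -dA inE negbK.
  by rewrite inE dA negbK.
apply: (@decider_classP _ _ P' b); split=> // x; rewrite /= PL /paccepts.
split=> [Nx|[t' /yP' xf] [t'' /(yields_det Pdet xf)[]//]].
have [[] [t' xt']] := yields_exists (Pb x); first by case: Nx; exists t'.
by exists t'; apply/yP'.
Qed.

Lemma FPt_program (W G : finType) (P : program ('I_2 + option W)%type G) b
    (f : word -> word -> word) :
  pdet P -> poly_bounded b ->
  (forall x y, pwithin P (input [tuple x; y]) (b (size x + size y))) ->
  (forall x y, exists2 t', yields P (input [tuple x; y]) true t' &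
     spells (f x y) (t' (inr None)).2) ->
  FPt (fun x y => [set f x y]).
Proof.
move=> Pdet [p bp] Pb Pf; split; last by move=> x y; exists (f x y).
split; first by move=> x y u v -> ->.
exists (machine_of P); split=> //.
  exists p => x; have [u [v ->]] := tuple2E x.
  rewrite /= addn0; apply/(@withinP _ (machine_of P)); rewrite machine_ofK.
  exact: within_le (Pb u v).
move=> x y; apply/seteqP; have [t' yt' zt'] := Pf x y.
split=> [z /outputsP[]|_ ->]; last first.
  by apply/outputsP; rewrite machine_ofK; exists t'.
rewrite machine_ofK => t'' /(yields_det Pdet yt')[_ <-] zz /=.
(* By determinism both words are spelled by the same tape, and a tape spells only one word. *)
elim: (f x y) z (t' _).2 zt' zz => [|c w IH] [|d z] g //=.
- by move=> -> [].
- by move=> [-> _].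
- by move=> [-> cw] [[->] /(IH z _ cw)->].
Qed.

Lemma NPMV_program (f : mvfun) : NPMV f ->
  exists (W G : finType) (P : program ('I_2 + option W)%type G) b,
   [/\ {homo b : m n / m <= n}, poly_bounded b,
      forall x y, pwithin P (input [tuple x; y]) (b (size x + size y)) &
      forall x y z, f x y z <->
        exists2 t', yields P (input [tuple x; y]) true t' &
          spells z (t' (inr None)).2].
Proof.
move=> [M [[p Mp] Mf]].
exists (work M), (aux M), (program_of M), (fun n => p.[n]%R); split.
- by move=> m n; apply: horner_nat_le.
- by exists p.
- by move=> x y; apply/withinP => n c /Mp; rewrite /= addn0.
- by move=> x y z; rewrite -(Mf x y) outputsP.
Qed.

(** * One-pass transducers *)

Section Tapes.
Variable G : finType.

(* The head stands on the blank just before the word. *)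
Definition ltape (w : word) : atape G :=
  act ((wtape G w).2 0, MoveL) (wtape G w).

Lemma ltape_nil : ltape [::] = btape G.
Proof. by congr pair; apply/funext => -[|[|[|n]]]. Qed.

Lemma ltape_cons b w : act (Some (inl b), MoveL) (ltape w) = ltape (b :: w).
Proof. by congr pair; apply/funext => -[|[|[|n]]]. Qed.

Lemma ltape_right w : act ((ltape w).2 0, MoveR) (ltape w) = wtape G w.
Proof. by congr pair; apply/funext => -[|[|[|n]]]. Qed.

Lemma spells_wtape w : spells w (wtape G w).2.
Proof. by elim: w => //= b w IH. Qed.

End Tapes.

Section Scanner.
Variables (I G O Q : finType) (i0 : I) (out : I -> option O) (q0 : Q).
Variable tr : Q -> bool -> {set Q * {ffun O -> option bool}}.
Hypothesis out_i0 : out i0 = None.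

Definition emit (o : option bool) (s : symbol G) : symbol G * direction :=
  if o is Some b then (Some (inl b), MoveL) else (s, MoveN).

Definition scan_move (a : {ffun O -> option bool}) (s : {ffun I -> symbol G}) :
    {ffun I -> symbol G * direction} :=
  [ffun i => if i == i0 then (s i, MoveR)
             else if out i is Some o then emit (a o) (s i) else (s i, MoveN)].

Definition scan_end (s : {ffun I -> symbol G}) :
    {ffun I -> symbol G * direction} :=
  [ffun i => (s i, if out i is Some _ then MoveR else MoveN)].

Definition scan_delta (q : option Q) (s : {ffun I -> symbol G}) :
    {set option Q * {ffun I -> symbol G * direction}} :=
  match q, tobit (s i0) with
  | Some q, Some b => [set (Some a.1, scan_move a.2 s) | a in tr q b]%SET
  | Some q, None => [set (None, scan_end s)]%SET
  | None, _ => finset.set0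
  end.

(* Reads the word on tape [i0] once; since each tape selected by [out] is written
   leftwards, it ends up with its head on the first letter, the last emitted
   bit. *)
Definition scanner : program I G :=
  Program (Some q0) [pred q | q == None] scan_delta.

Definition push (o : option bool) (w : word) : word :=
  if o is Some b then b :: w else w.

(** Input-output relation of the transducer; [acc] holds the words emitted so far, with the latest
    bit in front. *)
Fixpoint scans (q : Q) (x : word) (acc acc' : O -> word) : Prop :=
  if x is b :: x' then
    exists2 a, a \in tr q b & scans a.1 x' (fun o => push (a.2 o) (acc o)) acc'
  else acc' = acc.

Definition scanned_tapes (t : tapes I G) n (acc : O -> word) : tapes I G :=
  fun i => if i == i0 then iter n (fun u => act (u.2 0, MoveR) u) (t i)
           else if out i is Some o then wtape G (acc o) else t i.

Lemma acts_scan_move a (t : tapes I G) (acc : O -> word) :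
  (forall i o, out i = Some o -> t i = ltape G (acc o)) ->
  acts (scan_move a (scan t)) t = fun i =>
    if i == i0 then act ((t i).2 0, MoveR) (t i)
    else if out i is Some o then ltape G (push (a o) (acc o)) else t i.
Proof.
move=> tacc; apply/funext => i; rewrite /acts !ffunE; case: eqP => // _.
case E: (out i) => [o|]; last exact: act_id.
rewrite (tacc _ _ E) /emit /push; case: (a o) => [b|]; last exact: act_id.
exact: ltape_cons.
Qed.

Lemma acts_scan_end (t : tapes I G) (acc : O -> word) :
  (forall i o, out i = Some o -> t i = ltape G (acc o)) ->
  acts (scan_end (scan t)) t = scanned_tapes t 0 acc.
Proof.
move=> tacc; apply/funext => i; rewrite /acts /scanned_tapes !ffunE.
have [->|_] := eqVneq i i0; first by rewrite out_i0 act_id.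
by case E: (out i) => [o|]; rewrite ?act_id // (tacc _ _ E) ltape_right.
Qed.

(** During the pass the output heads stay on the cell before their words ([ltape]); the closing
    step, counted by the successor in the bound, turns this into [wtape]. *)
Lemma scanner_run x : forall q (t : tapes I G) acc,
  spells x (t i0).2 ->
  (forall i o, out i = Some o -> t i = ltape G (acc o)) ->
  within (@pnext _ _ scanner) (Some q, t) (size x).+1 /\
  forall t', ends (@pnext _ _ scanner) (Some q, t) (None, t') <->
    exists2 acc', scans q x acc acc' & t' = scanned_tapes t (size x) acc'.
Proof.
elim: x => [|b x IH] q t acc /= => [tx|[tb tx]] tacc.
  have nx d : pnext (P := scanner) (Some q, t) d <->
      d = (None, scanned_tapes t 0 acc).
    rewrite /pnext /= /scan_delta ffunE tx; split=> [[a /set1P-> ->]|->].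
      by rewrite (acts_scan_end tacc).
    by eexists; [apply/set1P; reflexivity | rewrite (acts_scan_end tacc)].
  have stN (t' : tapes I G) : stuck (@pnext _ _ scanner) (None, t').
    exact/pstuckP.
  split; first by apply: within_next => d /nx->; apply: within_stuck.
  have qe : pnext (P := scanner) (Some q, t) (None, scanned_tapes t 0 acc).
    exact/nx.
  move=> t'; rewrite (ends_next1 (None, t') qe); last by move=> d /nx.
  rewrite ends_stuck //; split=> [[->]|[_ -> ->] //]; by exists acc.
pose t1 a : tapes I G := fun i =>
  if i == i0 then act ((t i).2 0, MoveR) (t i)
  else if out i is Some o then ltape G (push (a o) (acc o)) else t i.
have nx d : pnext (P := scanner) (Some q, t) d <->
    exists2 a, a \in tr q b & d = (Some a.1, t1 a.2).
  rewrite /pnext /= /scan_delta ffunE tb; split.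
    by move=> [_ /imsetP[a aq ->] ->]; exists a; rewrite ?(acts_scan_move _ tacc).
  move=> [a aq ->]; exists (Some a.1, scan_move a.2 (scan t)).
    by apply/imsetP; exists a.
  by rewrite (acts_scan_move _ tacc).
have t1x a : spells x (t1 a i0).2 by rewrite /t1 eqxx.
have t1acc a i o : out i = Some o -> t1 a i = ltape G (push (a o) (acc o)).
  by rewrite /t1 => oi; rewrite oi; case: eqP oi => // ->; rewrite out_i0.
have t1E a acc' : scanned_tapes (t1 a) (size x) acc' =
    scanned_tapes t (size x).+1 acc'.
  apply/funext => i; rewrite /scanned_tapes iterSr /t1.
  by case: eqP => // _; case: (out i).
have IHa (a : Q * {ffun O -> option bool}) := IH a.1 (t1 a.2) _ (t1x a.2) (t1acc a.2).
split; first by apply: within_next => d /nx[a _ ->]; case: (IHa a).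
move=> t'; split.
  case: (pselect (exists d, pnext (P := scanner) (Some q, t) d)) => [[d qd]|N].
    move=> /(ends_next _ qd)[_ /nx[a aq ->] /(IHa a).2[acc' acca ->]].
    by exists acc'; [exists a | rewrite t1E].
  have st : stuck (@pnext _ _ scanner) (Some q, t).
    by move=> d qd; apply: N; exists d.
  by move/(ends_stuck _ st).
move=> [acc' [a aq acca] ->].
have qa : pnext (P := scanner) (Some q, t) (Some a.1, t1 a.2) by apply/nx; exists a.
apply/(ends_next _ qa); exists (Some a.1, t1 a.2) => //.
by apply/(IHa a).2; exists acc'; rewrite ?t1E.
Qed.

Section Start.
Variables (t : tapes I G) (x : word).
Hypotheses (tx : spells x (t i0).2) (t0 : forall i, out i -> t i = btape G).

Let tacc i o : out i = Some o -> t i = ltape G [::].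
Proof. by move=> oi; rewrite ltape_nil; apply: t0; rewrite oi. Qed.

Lemma scanner_within : pwithin scanner t (size x).+1.
Proof. by have [] := scanner_run q0 tx tacc. Qed.

Lemma scanner_yields t' : yields scanner t true t' <->
  exists2 acc, scans q0 x (fun=> [::]) acc & t' = scanned_tapes t (size x) acc.
Proof.
have [_ <-] := scanner_run q0 tx tacc.
split=> [[[q u] qu [/= /eqP qN ut]]|tt']; first by rewrite -ut -qN.
by exists (None, t').
Qed.

End Start.

End Scanner.

(** * Closure properties of P when P = NP *)

Section Matcher.
Variables (I G : finType) (i j : I) (strict : bool).

(** With [strict] this tests equality of the two words, otherwise only that the one on tape [i] is
    not longer. Failure is a missing move in the non-accepting state [false]. *)
Definition match_delta (q : bool) (s : {ffun I -> symbol G}) :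
    {set bool * {ffun I -> symbol G * direction}} :=
  match q, tobit (s i), tobit (s j) with
  | false, Some b, Some c =>
      if strict ==> (b == c) then
        [set (false,
          [ffun k => (s k, if (k == i) || (k == j) then MoveR else MoveN)])]%SET
      else finset.set0
  | false, None, o =>
      if strict && (o != None) then finset.set0
      else [set (true, [ffun k => (s k, MoveN)])]%SET
  | _, _, _ => finset.set0
  end.

Definition matcher : program I G := Program false [pred q | q] match_delta.

Fixpoint matches (u : word) (g : nat -> symbol G) : Prop :=
  if u is b :: u' then
    (exists2 c, tobit (g 0) = Some c & strict ==> (b == c)) /\
    matches u' (fun n => g n.+1)
  else strict -> tobit (g 0) = None.

Lemma matcher_run u : forall t : tapes I G, spells u (t i).2 ->
  pwithin matcher t (size u).+1 /\ (paccepts matcher t <-> matches u (t j).2).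
Proof.
have stT (t : tapes I G) : stuck (@pnext _ _ matcher) (true, t) by apply/pstuckP.
have yF t : stuck (@pnext _ _ matcher) (false, t) -> ~ paccepts matcher t.
  by move=> st [t' [d /(ends_stuck _ st)-> []]].
elim: u => [|b u IH] t /=.
  move=> ti.
  have dE : pdelta (p := matcher) false (scan t) =
      if strict && (tobit ((t j).2 0) != None) then finset.set0
      else [set (true, [ffun k => (scan t k, MoveN)])]%SET.
    by rewrite /= /match_delta !ffunE ti.
  case: ifP dE => [/andP[-> /eqP tj]|sj] dE.
    have st : stuck (@pnext _ _ matcher) (false, t) by apply/pstuckP.
    split; first exact: within_stuck.
    by split=> [/(yF _ st)//|/(_ isT)].
  have qt : pnext (P := matcher) (false, t) (true, t).
    by eexists; [rewrite dE; apply/set1P; reflexivity | rewrite acts_id].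
  have qt1 d : pnext (P := matcher) (false, t) d -> d = (true, t).
    by move=> [a]; rewrite dE => /set1P-> ->; rewrite acts_id.
  split; first by apply: within_next => d /qt1->; apply: within_stuck.
  split=> [_ sT|_]; first by move: sj; rewrite sT /=; case: eqP.
  exists t, (true, t) => //; apply/(ends_next1 _ qt) => //.
  by apply/(ends_stuck _ (stT t)).
move=> [tb tu].
case tc: (tobit ((t j).2 0)) => [c|]; last first.
  have st : stuck (@pnext _ _ matcher) (false, t).
    by apply/pstuckP; rewrite /= /match_delta !ffunE tb tc.
  split; first exact: within_stuck.
  by split=> [/(yF _ st)//|[[c]]].
have dE : pdelta (p := matcher) false (scan t) =
    if strict ==> (b == c) then [set (false,
       [ffun k => (scan t k, if (k == i) || (k == j) then MoveR else MoveN)])]%SET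
    else finset.set0.
  by rewrite /= /match_delta !ffunE tb tc.
case: ifP dE => [bc|bc] dE; last first.
  have st : stuck (@pnext _ _ matcher) (false, t) by apply/pstuckP.
  split; first exact: within_stuck.
  by split=> [/(yF _ st)//|[[_ [<-]]]]; rewrite bc.
set a := [ffun k => _] in dE.
have aE k : (k == i) || (k == j) -> acts a t k = act ((t k).2 0, MoveR) (t k).
  by move=> kij; rewrite /acts !ffunE kij.
have qt : pnext (P := matcher) (false, t) (false, acts a t).
  by exists (false, a) => //; rewrite dE; apply/set1P.
have qt1 d : pnext (P := matcher) (false, t) d -> d = (false, acts a t).
  by move=> [a']; rewrite dE => /set1P-> ->.
have [|IHw IHa] := IH (acts a t); first by rewrite aE ?eqxx.
split; first by apply: within_next => d /qt1->.
have -> : (exists2 c0, Some c = Some c0 & strict ==> (b == c0)) /\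
    matches u (fun n => (t j).2 n.+1) <-> matches u (acts a t j).2.
  by rewrite aE ?eqxx ?orbT //; split=> [[]//|?]; split=> //; exists c.
rewrite -IHa; split=> -[t' [d td dt]]; exists t', d => //.
  by apply/(ends_next1 _ qt qt1).
by move: td; rewrite /pends (ends_next1 _ qt qt1).
Qed.

End Matcher.

Lemma matches_spells (G : finType) u (g : nat -> symbol G) :
  matches true u g <-> spells u g.
Proof.
elim: u g => [|b u IH] g /=; first by split=> // /(_ isT).
by rewrite IH; split=> [[[c -> /eqP->]]|[->]] //; split=> //; exists b.
Qed.

Lemma matches_size (G : finType) u z (g : nat -> symbol G) : spells z g ->
  matches false u g <-> size u <= size z.
Proof.
elim: u z g => [|b u IH] [|c z] g //=; first by move=> ->; split=> // -[[]].
by move=> [-> /IH zg]; rewrite ltnS -zg; split=> [[]|] //; split=> //; exists c.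
Qed.

Lemma embed_wtape (H G : finType) (h : H -> G) w :
  wtape G w = htape h (wtape H w).
congr pair; apply/funext => n; first by case: n.
by elim: w n => [|b w IH] [|n] //; apply: IH.
Qed.

Lemma embed_btape (H G : finType) (h : H -> G) : btape G = htape h (btape H).
Proof. by congr pair; apply/funext => -[]. Qed.

Section Inner.
Variables (m : nat) (J G : finType).

Definition inner (j : J) : 'I_m + option J := inr (Some j).

Definition of_inner (i : 'I_m + option J) : option J :=
  if i is inr (Some j) then Some j else None.

Lemma innerK : pcancel inner of_inner. Proof. by []. Qed.

Lemma idK : pcancel (@id G) Some. Proof. by []. Qed.

Definition embed_inner (P : program J G) : program ('I_m + option J)%type G :=
  embed P inner of_inner id Some.

Lemma htape_id (t : atape G) : htape id t = t.
Proof. by case: t => l r; congr pair; apply/funext => n /=; case: (_ n) => [[]|]. Qed.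

Definition set_inner (t : tapes ('I_m + option J)%type G) (s : tapes J G) :
    tapes ('I_m + option J)%type G :=
  fun i => if i is inr (Some j) then s j else t i.

Lemma overlay_inner t s : overlay of_inner id t s = set_inner t s.
Proof. by apply/funext => -[k|[j|]] //; rewrite /overlay /= htape_id. Qed.

Section EmbedInner.
Variables (P : program J G) (t : tapes ('I_m + option J)%type G) (s : tapes J G).
Hypothesis ts : forall j, t (inner j) = s j.

Let tE : t = overlay of_inner id t s.
Proof. by rewrite overlay_inner; apply/funext => -[k|[j|]] //; apply: ts. Qed.

Lemma inner_within N : pwithin P s N -> pwithin (embed_inner P) t N.
Proof. by rewrite tE => /(embed_within innerK idK). Qed.

Lemma inner_yields b t' : yields (embed_inner P) t b t' <->
  exists2 s', yields P s b s' & t' = set_inner t s'.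
Proof.
rewrite [in X in X <-> _]tE (embed_yields P innerK idK).
by split=> -[s' Ps ->]; exists s' => //; rewrite overlay_inner.
Qed.

End EmbedInner.
End Inner.

Definition start_tapes (J G O : finType) (out : J -> option O)
    (acc : O -> word) : tapes J G :=
  fun j => if out j is Some o then wtape G (acc o) else btape G.

(** The common template for membership in NP: guess while scanning the input, then run [P] on work
    tapes holding the emitted words. *)
Lemma classNP_scan (J G O Q : finType) (out : J -> option O)
    (tr : Q -> bool -> {set Q * {ffun O -> option bool}}) q0
    (P : program J G) b (L : set word) :
  poly_bounded b ->
  (forall x acc, scans tr q0 x (fun=> [::]) acc ->
    pwithin P (start_tapes G out acc) (b (size x))) ->
  (forall x, L x <-> exists2 acc, scans tr q0 x (fun=> [::]) acc &
    paccepts P (start_tapes G out acc)) ->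
  classNP L.
Proof.
move=> bP Pb PL.
pose out' (i : 'I_1 + option J) := if of_inner i is Some j then out j else None.
pose i0 : 'I_1 + option J := inl ord0.
pose t x := input (G := G) (W := J) [tuple x].
have tx x : spells x (t x i0).2 by apply: spells_wtape.
have t0 x i : out' i -> t x i = btape G by case: i.
pose st x acc := scanned_tapes i0 out' (t x) (size x) acc.
have stE x acc j : st x acc (@inner 1 J j) = start_tapes G out acc j.
  by rewrite /st /scanned_tapes /start_tapes /out' /=; case: (out j).
have scW x := @scanner_within _ G _ _ i0 out' q0 tr erefl _ _ (tx x) (t0 x).
have scY x := @scanner_yields _ G _ _ i0 out' q0 tr erefl _ _ (tx x) (t0 x).
apply: (@classNP_program _ _
  (seqp (scanner G i0 out' q0 tr) (embed_inner 1 P)) (fun n => n.+1 + (b n).+1)).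
- have bS b' : poly_bounded b' -> poly_bounded (fun n => (b' n).+1).
    move=> ?; under eq_fun do rewrite -addn1.
    exact/poly_bounded_add/poly_bounded_cst.
  by apply: poly_bounded_add; apply: bS => //; apply: poly_bounded_id.
- move=> x; apply: seqp_within; first exact: scW.
  move=> _ /scY[acc xacc ->].
  by apply: (inner_within (stE x acc)); apply: Pb.
move=> x; rewrite PL; split=> [[acc xacc [s Ps]]|[t' /seqp_yields[_ /scY[acc xacc ->]]]].
  exists (set_inner (st x acc) s); apply/seqp_yields.
  by exists (st x acc); [apply/scY; exists acc | apply/(inner_yields _ (stE x acc)); exists s].
by move=> /(inner_yields _ (stE x acc))[s Ps _]; exists acc => //; exists s.
Qed.

Definition copy_bit (q : unit) (b : bool) : {set unit * {ffun unit -> option bool}} :=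
  [set (tt, [ffun=> Some b])]%SET.

Lemma scans_copy x acc acc' :
  scans copy_bit tt x acc acc' <-> acc' = fun=> catrev x (acc tt).
Proof.
elim: x acc acc' => [|b x IH] acc acc' /=.
  by split=> ->; apply/funext => -[].
split=> [[_ /set1P-> /IH->]|->]; first by rewrite ffunE.
by exists (tt, [ffun=> Some b]); [apply/set1P | apply/IH; rewrite ffunE].
Qed.

Definition to_input (W : finType) (j : 'I_1 + option W) : option unit :=
  if j is inl _ then Some tt else None.

Lemma start_input (W G : finType) (acc : unit -> word) :
  start_tapes G (@to_input W) acc = input [tuple acc tt].
Proof. by apply/funext => -[k|k] //=; rewrite /start_tapes /= (ord1 k). Qed.

Section PeqNP.
Hypothesis PNP : classP = classNP.

(** The transducer writes leftwards and so hands [P] the reversed input; the later constructions use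
    this lemma to undo that reversal. *)
Lemma classP_rev L : classP L -> classP (fun x => L (rev x)).
Proof.
rewrite [in X in _ -> X]PNP.
move=> /classP_decider[W [G [P [b [Pdet bm bP Pb PL]]]]].
apply: (@classNP_scan _ _ _ _ (@to_input W) copy_bit tt P b _ bP) => [x acc /scans_copy->|x].
  by rewrite start_input -[size x]size_rev; apply: Pb.
rewrite PL; split=> [Px|[acc /scans_copy->]]; last by rewrite start_input.
by eexists; [apply/scans_copy; reflexivity | rewrite start_input].
Qed.

(** Each program has its own copy of the input, its own tapes and its own symbols, so [P2'] still
    finds fresh tapes wherever a rejecting run of [P1'] has stopped. *)
Lemma classP_setU L1 L2 : classP L1 -> classP L2 -> classP (L1 `|` L2).
Proof.
move=> L1P L2P; suff: classP (fun x => L1 (rev x) \/ L2 (rev x)).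
  by move=> /classP_rev; congr classP; apply/funext => x; rewrite revK.
rewrite PNP.
have [W1 [G1 [P1 [b1 [P1det b1m b1P P1b P1L]]]]] := classP_decider L1P.
have [W2 [G2 [P2 [b2 [P2det b2m b2P P2b P2L]]]]] := classP_decider L2P.
pose J1 : finType := ('I_1 + option W1)%type.
pose J2 : finType := ('I_1 + option W2)%type.
pose G : finType := (G1 + G2)%type.
pose of1 (j : J1 + J2) := if j is inl j then Some j else None.
pose of2 (j : J1 + J2) := if j is inr j then Some j else None.
pose og1 (g : G1 + G2) := if g is inl g then Some g else None.
pose og2 (g : G1 + G2) := if g is inr g then Some g else None.
have k1 : pcancel (@inl J1 J2) of1 by [].
have k2 : pcancel (@inr J1 J2) of2 by [].
have o1 : ocancel of1 (@inl J1 J2) by case.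
have o2 : ocancel of2 (@inr J1 J2) by case.
have g1 : pcancel (@inl G1 G2) og1 by [].
have g2 : pcancel (@inr G1 G2) og2 by [].
pose P1' : program (J1 + J2)%type G := embed P1 inl of1 inl og1.
pose P2' : program (J1 + J2)%type G := embed P2 inr of2 inr og2.
pose out (j : J1 + J2) := match j with
  inl (inl _) | inr (inl _) => Some tt | _ => None end.
pose t w : tapes (J1 + J2)%type G := start_tapes G out (fun=> w).
have t1 w : overlay of1 inl (t w) (input [tuple w]) = t w.
  apply: (overlayE o1) => -[k|k]; rewrite /t /start_tapes /= ?(ord1 k).
    by apply: embed_wtape.
  by apply: embed_btape.
have t2 w s : overlay of2 inr (overlay of1 inl (t w) s) (input [tuple w]) =
    overlay of1 inl (t w) s.
  apply: (overlayE o2) => -[k|k]; rewrite /t /start_tapes /overlay /= ?(ord1 k).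
    by apply: embed_wtape.
  by apply: embed_btape.
have y1 w b t' : yields P1' (t w) b t' <->
    exists2 s, yields P1 (input [tuple w]) b s & t' = overlay of1 inl (t w) s.
  by rewrite -{1}t1; apply: embed_yields.
have y2 w s b t' : yields P2' (overlay of1 inl (t w) s) b t' <->
    exists2 s', yields P2 (input [tuple w]) b s' &
      t' = overlay of2 inr (overlay of1 inl (t w) s) s'.
  by rewrite -{1}t2; apply: embed_yields.
apply: (@classNP_scan _ _ _ _ out copy_bit tt (cond P1' (halt _ _ true) P2')
  (fun n => b1 n + (b2 n + 1))).
- apply: poly_bounded_add => //; apply: poly_bounded_add => //.
  exact: poly_bounded_cst.
- move=> x acc /scans_copy->; rewrite addn1 -[size x]size_rev.
  apply: cond_within.
  + by rewrite -/(t _) -t1; apply: embed_within.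
  + by move=> t' _; apply: halt_within.
  + by move=> _ /y1[s _ ->]; rewrite -t2; apply: embed_within.
move=> x; rewrite P1L P2L; split.
  move=> H; eexists; first by apply/scans_copy; reflexivity.
  have [b [s1 xs1]] := yields_exists (P1b (rev x)).
  case: b xs1 => xs1.
    exists (overlay of1 inl (t (rev x)) s1); apply/cond_yields.
    exists (overlay of1 inl (t (rev x)) s1); left.
    by split; [apply/y1; exists s1 | apply/halt_yields].
  case: H => [[s /(yields_det P1det xs1)[]//]|[s2 xs2]].
  exists (overlay of2 inr (overlay of1 inl (t (rev x)) s1) s2); apply/cond_yields.
  exists (overlay of1 inl (t (rev x)) s1); right.
  by split; [apply/y1; exists s1 | apply/y2; exists s2].
move=> [_ /scans_copy-> [t' /cond_yields[t'' [[/y1[s xs _] _]|]]]].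
  by left; exists s.
by move=> [/y1[s _ ->] /y2[s' xs' _]]; right; exists s'.
Qed.

End PeqNP.

(** * First-order definable relations between bounded words *)

(** Six is the number of variables in the final formula: tracks 0 and 1 carry the compared words, 2
    the candidate king, 3 and 4 the two points of the closure condition, 5 the middle point of a
    path. *)
Definition nextp r := if r == 5 then 0 else r.+1.

Fixpoint track (i r : nat) (x : word) : word :=
  if x is b :: x' then
    if r == i then b :: track i (nextp r) x' else track i (nextp r) x'
  else [::].

Fixpoint set_track (i r : nat) (x z : word) : word :=
  if x is b :: x' then
    if r == i then head b z :: set_track i (nextp r) x' (behead z)
    else b :: set_track i (nextp r) x' z
  else [::].

Fixpoint agrees (i r : nat) (x y : word) : Prop :=
  match x, y with
  | [::], [::] => True
  | b :: x', c :: y' => (r == i) || (c == b) /\ agrees i (nextp r) x' y'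
  | _, _ => False
  end.

Lemma agrees_size i r x y : agrees i r x y -> size y = size x.
Proof. by elim: x y r => [|b x IH] [|c y] r //= [_ /IH->]. Qed.

Lemma agrees_track i j r x y : j != i -> agrees i r x y ->
  track j r y = track j r x.
Proof.
move=> ji; elim: x y r => [|b x IH] [|c y] r //= [+ /IH->].
by case: (eqVneq r j) => [->|//]; rewrite (negPf ji) => /eqP->.
Qed.

Lemma agrees_set_track i r x z : agrees i r x (set_track i r x z).
Proof.
by elim: x r z => //= b x IH r z; case: eqP => ri /=; rewrite ?eqxx ?orbT.
Qed.

Lemma track_set_track i r x z : size z = size (track i r x) ->
  track i r (set_track i r x z) = z.
Proof.
elim: x r z => [|b x IH] r z /=; first by case: z.
case: eqP => ri /=; last by move/IH; case: eqP ri.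
by case: z => //= c z [/IH->]; rewrite ri eqxx.
Qed.

Lemma size_track_le i r x : size (track i r x) <= size x.
Proof.
by elim: x r => //= c x IH r; case: ifP => _; [apply: IH | apply: leqW (IH _)].
Qed.

Lemma size_track i n x : i < 6 -> size x = 6 * n -> size (track i 0 x) = n.
Proof.
move=> i6; elim: n x => [|n IH] x; first by case: x.
rewrite mulnS; do 6 (case: x => [//|? x]); rewrite -/(_ + _) => -[/IH <-].
by clear IH; do 6 (case: i i6 => [//|i] i6).
Qed.

Definition dec_step (p : bool * word) (b : bool) : bool * word :=
  if p.1 then (true, b :: p.2) else (b, p.2).

(* A word [w] is written on a track as [0...01] followed by the reversal of [w]. *)
Definition decode (z : word) : word := (foldl dec_step (false, [::]) z).2.

Definition encode n (w : word) : word := nseq (n - size w) false ++ true :: rev w.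

Lemma size_encode n w : size w <= n -> size (encode n w) = n.+1.
Proof. by move=> wn; rewrite size_cat size_nseq /= size_rev addnS subnK. Qed.

Lemma decode_started z w : foldl dec_step (true, w) z = (true, catrev z w).
Proof. by elim: z w => //= b z IH w; rewrite IH. Qed.

Lemma encodeK a w : decode (nseq a false ++ true :: rev w) = w.
Proof.
rewrite /decode foldl_cat (_ : foldl _ _ (nseq _ _) = (false, [::])).
  by rewrite /= decode_started catrevE revK cats0.
by elim: a.
Qed.

(** The marker costs one bit, and a track without marker decodes to the empty word. So arbitrary
    contents of [n.+1] bits decode exactly to the words of length at most [n], and a guess needs no
    validity check. *)
Lemma size_decode z : size (decode z) <= (size z).-1.
Proof.
rewrite /decode; elim: z => //= b z IH; case: b.
  by rewrite decode_started /= catrevE cats0 size_rev.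
exact: leq_trans IH (leq_pred _).
Qed.

Definition env (x : word) (i : nat) : word := decode (track i 0 x).

Definition upd (e : nat -> word) (i : nat) (z : word) : nat -> word :=
  fun j => if j == i then z else e j.

(* [Q] is decided in polynomial time on words of [6 * n.+1] bits, read as six
   interleaved tracks, each coding a word of length at most [n]. *)
Definition definable (Q : nat -> (nat -> word) -> Prop) : Prop :=
  exists2 L, classP L &
    forall n x, size x = 6 * n.+1 -> L x <-> Q n (env x).

Lemma definable_ext Q R : (forall n e, Q n e <-> R n e) -> definable Q -> definable R.
Proof. by move=> QR [L LP LQ]; exists L => // n x xn; rewrite LQ. Qed.

Lemma definable_not Q : definable Q -> definable (fun n e => ~ Q n e).
Proof.
move=> [L LP LQ]; exists (~` L); first exact: classP_setC.
by move=> n x /LQ <-.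
Qed.

Definition next_state (r : 'I_6) : 'I_6 := inord (nextp r).

Lemma next_stateE r : next_state r = nextp r :> nat.
Proof.
rewrite /next_state inordK // /nextp; case: eqP => // r5.
by rewrite ltn_neqAle (ltn_ord r) andbT; apply/eqP => -[].
Qed.

(** * Transducers that guess a track or decode several *)

Section Guess.
Variable i : nat.

Definition guess_bit (r : 'I_6) (b : bool) : {set 'I_6 * {ffun unit -> option bool}} :=
  [set (next_state r, [ffun=> Some c]) | c : bool & (r == i :> nat) || (c == b)]%SET.

Lemma scans_guess (r : 'I_6) x acc acc' : scans guess_bit r x acc acc' <->
  exists2 y, agrees i r x y & acc' = fun=> catrev y (acc tt).
Proof.
elim: x r acc acc' => [|b x IH] r acc acc' /=.
  split=> [->|[[|//] _ ->]]; last by apply/funext => -[].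
  by exists [::] => //; apply/funext => -[].
split.
  move=> [_ /imsetP[c + ->] /IH[y]]; rewrite inE next_stateE /= ffunE => rc xy ->.
  by exists (c :: y).
move=> [[|c y] // [rc xy] ->].
exists (next_state r, [ffun=> Some c]); first by apply/imsetP; exists c; rewrite ?inE.
by apply/IH; exists y; rewrite ?next_stateE ?ffunE.
Qed.

End Guess.

Section Extract.
Variables (O : finType) (ix : O -> nat).

(** The current track, and for each output whether its marker has been passed. Leftward emission
    undoes the reversal made by [encode]. *)
Definition extract_state : finType := ('I_6 * {ffun O -> bool})%type.

Definition extract_bit (q : extract_state) (b : bool) :
    {set extract_state * {ffun O -> option bool}} :=
  [set ((next_state q.1, [ffun o => q.2 o || (q.1 == ix o :> nat) && b]),
        [ffun o => if (q.1 == ix o :> nat) && q.2 o then Some b else None])]%SET.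

Lemma scans_extract (q : extract_state) x acc acc' :
  scans extract_bit q x acc acc' <->
  acc' = fun o => (foldl dec_step (q.2 o, acc o) (track (ix o) q.1 x)).2.
Proof.
elim: x q acc acc' => [//|b x IH] q acc acc' /=.
have accE : (fun o => (foldl dec_step
    ([ffun o => q.2 o || (q.1 == ix o :> nat) && b] o,
      push ([ffun o => if (q.1 == ix o :> nat) && q.2 o then Some b else None] o)
       (acc o)) (track (ix o) (nextp q.1) x)).2) =
  fun o => (foldl dec_step (q.2 o, acc o)
    (if q.1 == ix o :> nat then b :: track (ix o) (nextp q.1) x
     else track (ix o) (nextp q.1) x)).2.
  apply/funext => o; rewrite !ffunE; case: eqP => _ /=; last by rewrite orbF.
  by case: (q.2 o).
split=> [[_ /set1P-> /IH->]|->] /=; first by rewrite next_stateE.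
by eexists; [apply/set1P; reflexivity | apply/IH; rewrite /= next_stateE].
Qed.

End Extract.

Section PeqNP.
Hypothesis PNP : classP = classNP.

Lemma definable_or Q R : definable Q -> definable R ->
  definable (fun n e => Q n e \/ R n e).
Proof.
move=> [L LP LQ] [K KP KR]; exists (L `|` K); first exact: classP_setU.
by move=> n x xn; rewrite -LQ // -KR.
Qed.

Lemma definable_and Q R : definable Q -> definable R ->
  definable (fun n e => Q n e /\ R n e).
Proof.
move=> DQ DR.
have := definable_not (definable_or (definable_not DQ) (definable_not DR)).
congr definable; apply/funext => n; apply/funext => e; apply/propext.
by rewrite not_orE !notK.
Qed.

(** The transducer copies the input while replacing track [i] by guessed bits. Its output comes out
    reversed, hence [L] is first exchanged for its reversal. *)
Lemma definable_ex i Q : i < 6 -> definable Q ->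
  definable (fun n e => exists2 z, size z <= n & Q n (upd e i z)).
Proof.
move=> i6 [L /(classP_rev PNP) LP LQ].
exists (fun x => exists2 y, agrees i 0 x y & L y).
  rewrite PNP; have [W [G [P [b [Pdet bm bP Pb PL]]]]] := classP_decider LP.
  apply: (@classNP_scan _ _ _ _ (@to_input W) (guess_bit i) ord0 P b _ bP).
    move=> x acc /scans_guess[y xy ->]; rewrite start_input -(agrees_size xy).
    by rewrite -[size y]size_rev; apply: Pb.
  move=> x; split=> [[y xy Ly]|[acc /scans_guess[y xy ->]]].
    exists (fun=> rev y); first by apply/scans_guess; exists y.
    by rewrite start_input; apply/PL; rewrite revK.
  by rewrite start_input => /PL; rewrite catrevE cats0 revK; exists y.
move=> n x xn; split=> [[y xy Ly]|[z zn Qz]].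
  have yn : size y = 6 * n.+1 by rewrite (agrees_size xy).
  exists (env y i); first by rewrite (leq_trans (size_decode _)) ?(size_track i6 yn).
  suff -> : upd (env x) i (env y i) = env y by apply/LQ.
  apply/funext => j; rewrite /upd; case: eqVneq => [->//|ji].
  by rewrite /env (agrees_track ji xy).
exists (set_track i 0 x (encode n z)); first exact: agrees_set_track.
apply/(LQ n); first by rewrite (agrees_size (agrees_set_track _ _ _ _)).
suff -> : env (set_track i 0 x (encode n z)) = upd (env x) i z by [].
apply/funext => j; rewrite /upd /env; case: eqVneq => [->|ji].
  by rewrite track_set_track ?encodeK // size_encode ?(size_track i6 xn).
by rewrite (agrees_track ji (agrees_set_track _ _ _ _)).
Qed.

(** The extra tape [inr tt] keeps a second copy of [e i], to be compared with tape [k] after [P] may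
    have overwritten its inputs. Taking [k] as the output tape tests a value of a function; taking
    it as the second input of a program that halts at once compares lengths. *)
Lemma definable_machine (W G : finType) (P : program ('I_2 + option W)%type G)
    b (k : 'I_2 + option W) strict i j :
  {homo b : m n / m <= n} -> poly_bounded b ->
  (forall u v, pwithin P (input [tuple u; v]) (b (size u + size v))) ->
  definable (fun _ e =>
    exists2 t, yields P (input [tuple e i; e j]) true t & matches strict (e i) (t k).2).
Proof.
move=> bm bP Pb.
pose J : finType := (('I_2 + option W) + unit)%type.
pose out (l : J) := match l with
  inl (inl o) => Some (o == ord0) | inl (inr _) => None | inr _ => Some true end.
pose ix (o : bool) := if o then i else j.
pose of_inl (l : J) := if l is inl l' then Some l' else None.
pose P1 : program J G := embed P inl of_inl id Some.
pose P2 : program J G := matcher G (inr tt) (inl k) strict.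
pose q0 : extract_state bool := (ord0, [ffun=> false]).
pose accx x o := decode (track (ix o) 0 x).
have ik : pcancel (@inl ('I_2 + option W) unit) of_inl by [].
have io : ocancel of_inl (@inl ('I_2 + option W) unit) by case.
have scE x acc : scans (extract_bit ix) q0 x (fun=> [::]) acc <-> acc = accx x.
  rewrite scans_extract /accx /decode /=.
  by under eq_fun do rewrite ffunE.
pose t x : tapes J G := start_tapes G out (accx x).
have tE x : overlay of_inl id (t x) (input [tuple env x i; env x j]) = t x.
  apply: (overlayE io) => -[o|o]; rewrite htape_id /t /start_tapes //=.
  by case: o => [[|[|]]].
have P1y x c t' : yields P1 (t x) c t' <->
    exists2 s, yields P (input [tuple env x i; env x j]) c s &
      t' = overlay of_inl id (t x) s.
  by rewrite -{1}tE; apply: embed_yields.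
have env_le x l : size (env x l) <= size x.
  exact: leq_trans (size_decode _) (leq_trans (leq_pred _) (size_track_le _ _ _)).
exists (fun x => exists2 t, yields P (input [tuple env x i; env x j]) true t &
  matches strict (env x i) (t k).2) => //.
rewrite PNP; apply: (@classNP_scan _ _ _ _ out (extract_bit ix) q0 (seqp P1 P2)
    (fun n => b (n + n) + (n.+1).+1)).
- apply: poly_bounded_add; first apply: (poly_bounded_comp bP).
    by apply: poly_bounded_add; apply: poly_bounded_id.
  under eq_fun do rewrite -addn2.
  by apply: poly_bounded_add; [apply: poly_bounded_id | apply: poly_bounded_cst].
- move=> x acc /scE->; apply: seqp_within.
    rewrite -/(t x) -tE; apply: (embed_within ik (@idK G)).
    by apply: within_le (Pb _ _); apply: bm; apply: leq_add.
  move=> t' /P1y[s _ ->]; have [|H _] := @matcher_run _ G (inr tt) (inl k) strict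
      (env x i) (overlay of_inl id (t x) s); first exact: spells_wtape.
  by apply: within_le H; rewrite ltnS.
move=> x; have mP s : paccepts P2 (overlay of_inl id (t x) s) <->
    matches strict (env x i) (s k).2.
  have [|_ ->] := @matcher_run _ G (inr tt) (inl k) strict
      (env x i) (overlay of_inl id (t x) s); first exact: spells_wtape.
  by have -> : overlay of_inl id (t x) s (inl k) = s k by apply: htape_id.
split=> [[s xs sk]|[_ /scE-> [t' /seqp_yields[_ /P1y[s xs ->] st]]]].
  exists (accx x); first exact/scE.
  have /mP[t' st'] := sk; exists t'; apply/seqp_yields.
  by exists (overlay of_inl id (t x) s) => //; apply/P1y; exists s.
by exists s => //; apply/mP; exists t'.
Qed.

Lemma definable_size i j : definable (fun _ e => size (e i) <= size (e j)).
Proof.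
have H u v : pwithin (halt ('I_2 + option void)%type void true)
    (input [tuple u; v]) 0 by apply: halt_within.
have := @definable_machine void void (halt _ _ true) (fun=> 0) (inl (inord 1)) false i j
  (fun _ _ _ => leqnn 0) (poly_bounded_cst 0) H.
congr definable; apply/funext => n; apply/funext => e; apply/propext.
have jE : spells (e j) (input (W := void) (G := void) [tuple e i; e j] (inl (inord 1))).2.
  by rewrite /= (tnth_nth [::]) inordK //=; apply: spells_wtape.
rewrite -(matches_size (e i) jE); split=> [[t /halt_yields[_ ->]] //|?].
by exists (input [tuple e i; e j]) => //; apply/halt_yields.
Qed.

Lemma definable_output f i j : NPMV f ->
  definable (fun _ e => f (e i) (e j) (e i)).
Proof.
move=> /NPMV_program[W [G [P [b [bm bP Pb Pf]]]]].
have := @definable_machine W G P b (inr None) true i j bm bP Pb.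
congr definable; apply/funext => n; apply/funext => e; apply/propext.
by rewrite Pf; split=> -[t et /matches_spells te]; exists t.
Qed.

End PeqNP.

(** * Interleaving two words *)

Section DeterministicRuns.
Variables (I G : finType) (P : program I G).
Hypothesis Pdet : pdet P.

Definition runs (c d : pconfig P) N :=
  ends (@pnext _ _ P) c d /\ within (@pnext _ _ P) c N.

Lemma runs_next c d e N : pnext c d -> runs d e N -> runs c e N.+1.
Proof.
move=> cd [de dN]; have cd1 b : pnext c b -> b = d.
  by move=> cb; apply: (pnext_det Pdet cb cd).
split; first exact/(ends_next1 _ cd cd1).
by apply: within_next => b /cd1->.
Qed.

Lemma runs_stuck c : stuck (@pnext _ _ P) c -> runs c c 0.
Proof. by move=> cS; split; [apply/ends_stuck | apply: within_stuck]. Qed.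

End DeterministicRuns.

Section Zippers.
Variable G : finType.

(** [p] lists the letters already passed, latest first, and [w] those still ahead. *)
Definition ztape (p w : word) : atape G :=
  cells ([seq Some (inl b) | b <- p], [seq Some (inl b) | b <- w]) .

Lemma ztape_right p b w :
  act ((ztape p (b :: w)).2 0, MoveR) (ztape p (b :: w)) = ztape (b :: p) w.
Proof. by congr pair; apply/funext => -[|n]. Qed.

Lemma ztape_left p b w :
  act ((ztape (b :: p) w).2 0, MoveL) (ztape (b :: p) w) = ztape p (b :: w).
Proof. by congr pair; apply/funext => -[|[|n]]. Qed.

End Zippers.

Section Copier.
Variables (I G : finType) (i o : I).
Hypothesis io : i != o.

(** The state [Some false] only steps back from the cell behind the word onto its last letter. *)
Definition copy_delta (q : option bool) (s : {ffun I -> symbol G}) :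
    {set option bool * {ffun I -> symbol G * direction}} :=
  match q, tobit (s i) with
  | Some false, _ =>
      [set (Some true, [ffun k => (s k, if k == i then MoveL else MoveN)])]%SET
  | Some true, Some b =>
      [set (Some true, [ffun k => if k == o then (Some (inl b), MoveL)
                                  else (s k, if k == i then MoveL else MoveN)])]%SET
  | Some true, None =>
      [set (None, [ffun k => (s k, if k == o then MoveR else MoveN)])]%SET
  | None, _ => finset.set0
  end.

(* Copies the word before the head of tape [i], from right to left. *)
Definition copier : program I G :=
  Program (Some false) [pred q | q == None] copy_delta.

Lemma copier_det : pdet copier.
Proof.
by move=> [[]|] s /=; rewrite /copy_delta ?cards0 ?cards1 //; case: tobit => [?|];
   rewrite cards1.
Qed.

Lemma copier_loop p : forall w acc (t : tapes I G),
  t i = act ((ztape G p w).2 0, MoveL) (ztape G p w) -> t o = ltape G acc ->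
  exists2 t', runs (P := copier) (Some true, t) (None, t') (size p).+1 &
    t' o = wtape G (catrev p acc).
Proof.
elim: p => [|b p IH] w acc t ti to.
  set a := [ffun k => (scan t k, if k == o then MoveR else MoveN)].
  exists (acts a t); last by rewrite /acts !ffunE eqxx to ltape_right.
  apply: (runs_next copier_det (d := (None, acts a t))).
    by exists (None, a); rewrite //= /copy_delta !ffunE ti; apply/set1P.
  exact/runs_stuck/pstuckP.
rewrite ztape_left in ti.
set a := [ffun k => if k == o then (Some (inl b), MoveL)
                    else (scan t k, if k == i then MoveL else MoveN)].
have [||t' tt' t'o] := IH (b :: w) (b :: acc) (acts a t).
- by rewrite /acts !ffunE (negPf io) eqxx ti.
- by rewrite /acts !ffunE eqxx to ltape_cons.
exists t' => //; apply: (runs_next copier_det _ tt').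
by exists (Some true, a); rewrite //= /copy_delta !ffunE ti; apply/set1P.
Qed.

Lemma copier_run p w (t : tapes I G) : t i = ztape G p w -> t o = btape G ->
  exists2 t', yields copier t true t' & spells (rev p) (t' o).2 /\
    pwithin copier t (size p).+2.
Proof.
move=> ti to.
set a := [ffun k => (scan t k, if k == i then MoveL else MoveN)].
have [||t' tt' t'o] := @copier_loop p w [::] (acts a t).
- by rewrite /acts !ffunE eqxx ti.
- by rewrite /acts !ffunE eq_sym (negPf io) to ltape_nil -to act_id.
have [tE tW] : runs (P := copier) (Some false, t) (None, t') (size p).+2.
  apply: (runs_next copier_det _ tt').
  by exists (Some true, a); rewrite //= /copy_delta; apply/set1P.
exists t'; first by exists (None, t').
by rewrite t'o; split => //; apply: spells_wtape.
Qed.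

End Copier.

Lemma track_cat i m u v : size u = 6 * m ->
  track i 0 (u ++ v) = track i 0 u ++ track i 0 v.
Proof.
elim: m u => [|m IH] u; first by case: u.
rewrite mulnS; do 6 (case: u => [//|? u]); move=> -[um] /=.
by rewrite (IH _ um); do 6 (case: ifP => _).
Qed.

Section Encoder.
Variables (I G : finType) (i0 i1 o : I).
Hypothesis i01 : i0 != i1.

Definition enc_move (d0 d1 : direction) (b : bool) (d : direction)
    (s : {ffun I -> symbol G}) : {ffun I -> symbol G * direction} :=
  [ffun k => if k == i0 then (s k, d0) else if k == i1 then (s k, d1)
             else if k == o then (Some (inl b), d) else (s k, MoveN)].

Definition skip (b : option bool) : direction := if b is Some _ then MoveR else MoveN.

Definition enc_state : finType := option ('I_6 * bool * bool)%type.

(** A column is written from track 5 down to track 0. Tracks 5 to 2 get filler bits, since their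
    variables are bound by quantifiers. Once a word is exhausted, [odflt] supplies its marker the
    first time and padding afterwards. After the last bit the head stays, so that it stands on the
    first letter of the result. *)
Definition enc_delta (q : enc_state) (s : {ffun I -> symbol G}) :
    {set enc_state * {ffun I -> symbol G * direction}} :=
  let b0 := tobit (s i0) in let b1 := tobit (s i1) in
  if q is Some (r, f0, f1) then
    match nat_of_ord r with
    | 0 =>
      let f0' := f0 || ~~ b0 in
      let stop := f0' && f1 in
      [set (if stop then None else Some (inord 5, f0', f1),
            enc_move (skip b0) MoveN (odflt (~~ f0) b0)
              (if stop then MoveN else MoveL) s)]%SET
    | 1 =>
      [set (Some (inord 0, f0, f1 || ~~ b1),
            enc_move MoveN (skip b1) (odflt (~~ f1) b1) MoveL s)]%SET
    | r'.+1 => [set (Some (inord r', f0, f1), enc_move MoveN MoveN false MoveL s)]%SET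
    end
  else finset.set0.

(* Interleaves the words on tapes [i0] and [i1], last columns first; the flags
   tell for which of them the marker [true] has been written. *)
Definition encoder : program I G :=
  Program (Some (inord 5, false, false)) [pred q | q == None] enc_delta.

Lemma encoder_det : pdet encoder.
Proof.
move=> [[[r f0] f1]|] s /=; last by rewrite cards0.
by rewrite /enc_delta; case: (nat_of_ord r) => [|[|?]]; rewrite cards1.
Qed.

Variable t : tapes I G.

Definition enc_tapes (a0 a1 a : atape G) : tapes I G :=
  fun k => if k == i0 then a0 else if k == i1 then a1
           else if k == o then a else t k.

Lemma enc_tapes0 a0 a1 a : enc_tapes a0 a1 a i0 = a0.
Proof. by rewrite /enc_tapes eqxx. Qed.

Lemma enc_tapes1 a0 a1 a : enc_tapes a0 a1 a i1 = a1.
Proof. by rewrite /enc_tapes eq_sym (negPf i01) eqxx. Qed.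

Lemma acts_enc_move d0 d1 b d a0 a1 a :
  acts (enc_move d0 d1 b d (scan (enc_tapes a0 a1 a))) (enc_tapes a0 a1 a) =
  enc_tapes (act (a0.2 0, d0) a0) (act (a1.2 0, d1) a1) (act (Some (inl b), d) a).
Proof.
apply/funext => k; rewrite /acts !ffunE /enc_tapes; case: eqP => // _.
by case: eqP => // _; case: eqP => // _; rewrite act_id.
Qed.

Lemma ztape_skip p (w : word) :
  let a := ztape G p w in
  act (a.2 0, skip (tobit (a.2 0))) a =
  ztape G (if w is b :: _ then b :: p else p) (behead w).
Proof. by case: w => [|b w] a; rewrite ?ztape_right // act_id. Qed.

Lemma tobit_ztape p (w : word) : tobit ((ztape G p w).2 0) = ohead w.
Proof. by case: w. Qed.

Lemma enc_filler f0 f1 a0 a1 j acc e N : j <= 4 ->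
  runs (P := encoder) (Some (inord 1, f0, f1), enc_tapes a0 a1 (ltape G (nseq j false ++ acc))) e N ->
  runs (P := encoder) (Some (inord j.+1, f0, f1), enc_tapes a0 a1 (ltape G acc)) e (j + N).
Proof.
elim: j acc => [//|j IH] acc j4 H; rewrite addSn.
have jE : nseq j.+1 false ++ acc = nseq j false ++ false :: acc.
  by rewrite -(addn1 j) nseqD -catA.
rewrite jE in H.
apply: (runs_next encoder_det _ (IH (false :: acc) (ltnW j4) H)).
exists (Some (inord j.+1, f0, f1),
  enc_move MoveN MoveN false MoveL (scan (enc_tapes a0 a1 (ltape G acc)))) => /=.
  by rewrite inordK //; apply/set1P.
by rewrite acts_enc_move !act_id ltape_cons.
Qed.

(** The flag [f] records that the marker is out. Then [tail] is what the track still lacks up to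
    padding, and [columns] counts the columns this takes; the larger count of the two tracks is the
    measure in [encoder_run]. *)
Definition tail (f : bool) (w : word) : word := if f then [::] else true :: rev w.

Definition columns (f : bool) (w : word) : nat := if f then 0 else (size w).+1.

Definition enc_bit (f : bool) (w : word) : bool := odflt (~~ f) (ohead w).

(** Tracks are written from their end, so the bit written now is the last one of what is missing; if
    the marker is already out, it is one more padding bit. *)
Lemma tail_step a (f : bool) (w : word) : (f -> w = [::]) -> exists a',
  (nseq a false ++ tail (f || nilp w) (behead w)) ++ [:: enc_bit f w] =
  nseq a' false ++ tail f w.
Proof.
move=> fw; case: f fw => [/(_ isT)->|_].
  by exists a.+1; rewrite -(addn1 a) nseqD /= !cats0.
by case: w => [|b w]; exists a; rewrite /= ?cats0 // -catA /= rev_cons cats1.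
Qed.

Definition zip_done (p w : word) : word := if w is b :: _ then b :: p else p.

Lemma columns_step (f : bool) (w : word) : (f -> w = [::]) ->
  columns (f || nilp w) (behead w) = (columns f w).-1.
Proof. by case: f => [/(_ isT)->|_] //; case: w. Qed.

Lemma columns_eq0 f w : (columns f w == 0) = f.
Proof. by case: f. Qed.

Definition column f0 f1 x y : word :=
  [:: enc_bit f0 x, enc_bit f1 y & nseq 4 false].

Lemma ltape_last b acc : act (Some (inl b), MoveN) (ltape G acc) = wtape G (b :: acc).
Proof. by congr pair; apply/funext => -[|[|n]]. Qed.

Lemma enc_column (f0 f1 : bool) (x y p0 p1 acc : word) e N :
  let f0' := f0 || nilp x in let f1' := f1 || nilp y in
  let stop := f0' && f1' in
  let a := if stop then wtape G (column f0 f1 x y ++ acc)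
           else ltape G (column f0 f1 x y ++ acc) in
  runs (P := encoder) (if stop then None else Some (inord 5, f0', f1'),
      enc_tapes (ztape G (zip_done p0 x) (behead x))
                (ztape G (zip_done p1 y) (behead y)) a) e N ->
  runs (P := encoder) (Some (inord 5, f0, f1),
      enc_tapes (ztape G p0 x) (ztape G p1 y) (ltape G acc)) e (4 + N.+2).
Proof.
move=> f0' f1' stop a H; apply: enc_filler => //.
have nilE (w : word) : ~~ ohead w = nilp w by case: w.
set T := enc_tapes _ _ _; set acc' := nseq 4 false ++ acc in T *.
pose T' := enc_tapes (ztape G p0 x) (ztape G (zip_done p1 y) (behead y))
  (ltape G (enc_bit f1 y :: acc')).
apply: (runs_next encoder_det (d := (Some (inord 0, f0, f1'), T'))).
  exists (Some (inord 0, f0, f1'),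
    enc_move MoveN (skip (ohead y)) (enc_bit f1 y) MoveL (scan T)) => /=.
    by rewrite inordK //= !ffunE /T enc_tapes1 tobit_ztape nilE; apply/set1P.
  rewrite acts_enc_move act_id ltape_cons; congr (_, enc_tapes _ _ _).
  by rewrite -{1}(tobit_ztape p1) ztape_skip.
apply: (runs_next encoder_det _ H).
exists (if stop then None else Some (inord 5, f0', f1'),
   enc_move (skip (ohead x)) MoveN (enc_bit f0 x)
     (if stop then MoveN else MoveL) (scan T')) => /=.
  by rewrite inordK //= !ffunE /T' enc_tapes0 tobit_ztape nilE; apply/set1P.
rewrite acts_enc_move act_id; congr (_, enc_tapes _ _ _).
  by rewrite -{1}(tobit_ztape p0) ztape_skip.
by rewrite /a; case: ifP => _; rewrite ?ltape_last ?ltape_cons.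
Qed.

(** Each step writes one bit, so the length of [z] is also the running time. The track finished
    first is padded until the other one is complete. *)
Lemma encoder_run n : forall (f0 f1 : bool) (x y p0 p1 acc : word),
  (f0 -> x = [::]) -> (f1 -> y = [::]) ->
  maxn (columns f0 x) (columns f1 y) = n.+1 ->
  exists z, [/\ size z = 6 * n.+1,
    exists a, track 0 0 z = nseq a false ++ tail f0 x,
    exists a, track 1 0 z = nseq a false ++ tail f1 y &
    runs (P := encoder)
      (Some (inord 5, f0, f1), enc_tapes (ztape G p0 x) (ztape G p1 y) (ltape G acc))
      (None, enc_tapes (ztape G (catrev x p0) [::]) (ztape G (catrev y p1) [::])
                       (wtape G (z ++ acc))) (6 * n.+1)].
Proof.
elim: n => [|n IH] f0 f1 x y p0 p1 acc f0x f1y fn.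
all: have revE (w p : word) : catrev (behead w) (zip_done p w) = catrev w p by case: w.
all: have f'n : maxn (columns (f0 || nilp x) (behead x))
    (columns (f1 || nilp y) (behead y)) = (maxn (columns f0 x) (columns f1 y)).-1
  by rewrite !columns_step //; case: (columns f0 x) (columns f1 y) => [|?] [|?];
     rewrite ?maxnSS ?max0n ?maxn0.
all: rewrite fn /= in f'n.
  have [f0' f1'] : f0 || nilp x /\ f1 || nilp y.
    rewrite -(columns_eq0 (f0 || _) (behead x)) -(columns_eq0 (f1 || _) (behead y)).
    by rewrite -!leqn0 -f'n leq_maxl leq_maxr.
  have [a0 a0E] := tail_step 0 f0x; have [a1 a1E] := tail_step 0 f1y.
  exists (column f0 f1 x y); split=> //.
  - by exists a0; rewrite -a0E f0'.
  - by exists a1; rewrite -a1E f1'.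
  apply: (enc_column (N := 0)); rewrite f0' f1' /=.
  have x0 : x = [::] by case/orP: f0' => [/f0x|/nilP].
  have y0 : y = [::] by case/orP: f1' => [/f1y|/nilP].
  by rewrite x0 y0 /=; apply/runs_stuck/pstuckP.
have f0x' : f0 || nilp x -> behead x = [::] by case/orP => [/f0x->|/nilP->].
have f1y' : f1 || nilp y -> behead y = [::] by case/orP => [/f1y->|/nilP->].
have [z [zn [a0 z0] [a1 z1] zr]] := IH _ _ _ _ (zip_done p0 x) (zip_done p1 y)
  (column f0 f1 x y ++ acc) f0x' f1y' f'n.
exists (z ++ column f0 f1 x y); split.
- by rewrite size_cat zn -mulnSr.
- by have [a aE] := tail_step a0 f0x; exists a; rewrite (track_cat _ _ zn) z0 -aE.
- by have [a aE] := tail_step a1 f1y; exists a; rewrite (track_cat _ _ zn) z1 -aE.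
have -> : 6 * n.+2 = 4 + (6 * n.+1).+2 by rewrite (mulnS 6 n.+1).
have stopF : (f0 || nilp x) && (f1 || nilp y) = false.
  apply/negP => /andP[f0' f1'].
  by move: f'n; rewrite f0' f1'.
by apply: enc_column; rewrite stopF -catA -!(revE x) -!(revE y) in zr *.
Qed.

(** The length of [z] makes the level read off by [definable] equal to the level at which [chooses]
    compares [x] and [y]. *)
Lemma encoder_encodes x y :
  t i0 = wtape G x -> t i1 = wtape G y -> t o = btape G ->
  let n := maxn (size x) (size y) in
  exists z, [/\ size z = 6 * n.+1, env z 0 = x, env z 1 = y,
    pwithin encoder t (6 * n.+1) &
    yields encoder t true (enc_tapes (ztape G (rev x) [::]) (ztape G (rev y) [::])
                                     (wtape G z))].
Proof.
move=> tx ty to n.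
have [//|//||z [zn [a0 z0] [a1 z1] [zE zW]]] :=
  @encoder_run n false false x y [::] [::] [::]; first by rewrite /= maxnSS.
have tE : t = enc_tapes (ztape G [::] x) (ztape G [::] y) (ltape G [::]).
  apply/funext => k; rewrite /enc_tapes ltape_nil.
  by case: eqP => [->//|_]; case: eqP => [->//|_]; case: eqP => [->|].
exists z; rewrite /env z0 z1 !encodeK; split=> //; first by rewrite tE.
by rewrite {1}tE; eexists; [exact: zE | rewrite /= cats0].
Qed.

End Encoder.

(** * The associative selector *)

Section ChoiceFunction.
Variables (r : word -> word -> Prop) (Q : nat -> (nat -> word) -> Prop).
Hypothesis Qdef : definable Q.
Hypothesis Qr : forall e, Q (maxn (size (e 0)) (size (e 1))) e <-> r (e 0) (e 1).

(** The encoder preserves the two inputs and leaves the heads behind them, exactly where [copier]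
    starts; the decider runs on separate tapes in between. *)
Lemma choice_of_FPt : FPt (choice_of r).
Proof.
have [L /classP_decider[W [G [P [b [Pdet bm bP Pb PL]]]]] LQ] := Qdef.
pose J : finType := ('I_1 + option W)%type.
pose I : finType := ('I_2 + option J)%type.
pose i0 : I := inl ord0.
pose i1 : I := inl ord_max.
pose o : I := inner 2 (inl ord0 : J).
pose out : I := inr None.
pose enc : program I G := encoder G i0 i1 o.
pose D : program I G := embed_inner 2 P.
pose C0 : program I G := copier G i0 out.
pose C1 : program I G := copier G i1 out.
have C0run p w t : t i0 = ztape G p w -> t out = btape G -> _ :=
  @copier_run I G i0 out isT p w t.
have C1run p w t : t i1 = ztape G p w -> t out = btape G -> _ :=
  @copier_run I G i1 out isT p w t.
(* Encoder, decider on a word of length at most [6 * s + 6], and copier with its two steps beyond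
   the letters; the outer successors are the jumps of [seqp] and [cond]. *)
pose bound s := 6 * s + 6 + (b (6 * s + 6) + (s + 2).+1).+1.
apply: (@FPt_program J G (seqp enc (cond D C0 C1)) bound
  (fun x y => if `[< r x y >] then x else y)).
- apply: cond_det; [exact: encoder_det | | exact: halt_det].
  by apply: cond_det; [apply: embed_det | exact: copier_det | exact: copier_det].
- have aP : poly_bounded (fun s => 6 * s + 6).
    exact/poly_bounded_affine/poly_bounded_id.
  apply: poly_bounded_add => //; under eq_fun do rewrite -addn1.
  apply: poly_bounded_add; last exact: poly_bounded_cst.
  apply: poly_bounded_add; first exact: poly_bounded_comp bP aP.
  under eq_fun do rewrite -addnS.
  by apply: poly_bounded_add; [apply: poly_bounded_id | apply: poly_bounded_cst].
all: move=> x y; set t := input _.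
all: have [//|//|//|z [zn zx zy encW encY]] :=
  @encoder_encodes I G i0 i1 o isT t x y.
all: set s1 := enc_tapes _ _ _ _ _ _ _ in encY.
all: have s1E j : s1 (inner 2 j) = input [tuple z] j
  by case: j => [k|k]; rewrite /s1 /enc_tapes ?(ord1 k).
all: have DY c t' := @inner_yields 2 J G P s1 (input [tuple z]) s1E c t'.
all: have DW N := @inner_within 2 J G P s1 (input [tuple z]) s1E N.
all: have s0 s : set_inner s1 s i0 = ztape G (rev x) [::] by [].
all: have s2 s : set_inner s1 s i1 = ztape G (rev y) [::] by [].
all: have so s : set_inner s1 s out = btape G by [].
- have mxy : maxn (size x) (size y) <= size x + size y.
    by rewrite geq_max leq_addr leq_addl.
  have zle : 6 * (maxn (size x) (size y)).+1 <= 6 * (size x + size y) + 6.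
    by rewrite mulnS addnC leq_add2r leq_mul2l.
  apply: seqp_within; first exact: within_le encW.
  move=> t' /(yields_det (@encoder_det I G i0 i1 o) encY)[_ <-].
  apply: cond_within; first by apply/DW/(within_le _ (Pb z)); rewrite bm ?zn.
    move=> _ /DY[s _ ->]; have [t'' _ [_ H]] := C0run _ _ _ (s0 s) (so s).
    by apply: within_le H; rewrite size_rev -addn2 leq_add2r leq_addr.
  move=> _ /DY[s _ ->]; have [t'' _ [_ H]] := C1run _ _ _ (s2 s) (so s).
  by apply: within_le H; rewrite size_rev -addn2 leq_add2r leq_addl.
have [c [s zs]] := yields_exists (Pb z).
have cr : c <-> r x y.
  have := Qr (env z); rewrite zx zy -(LQ _ _ zn) => <-; rewrite PL.
  split=> [cT|[s' zs']]; first by exists s; case: c cT zs.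
  by have [-> _] := yields_det Pdet zs zs'.
have [t0 t0Y [t0S _]] := C0run _ _ _ (s0 s) (so s).
have [t1 t1Y [t1S _]] := C1run _ _ _ (s2 s) (so s).
exists (if c then t0 else t1).
  apply/seqp_yields; exists s1 => //; apply/cond_yields; exists (set_inner s1 s).
  by case: c zs {cr} => zs; [left|right]; split=> //; apply/DY; exists s.
rewrite (_ : `[< r x y >] = c); last by apply/asboolP/idP; rewrite cr.
by case: c {zs cr}; rewrite ?(revK x) ?(revK y) in t0S t1S *.
Qed.

End ChoiceFunction.

Section Selectors.
Hypothesis PNP : classP = classNP.
Variables (f : mvfun) (B : set word).
Hypotheses (fNP : NPMV f) (fB : selector f B).

(** Both argument orders occur because [f] need not be symmetric. Totality becomes the excluded
    middle for one membership, and each disjunct asks whether a first argument is a value, the form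
    treated by [definable_output]. *)
Definition edge (u v : word) : Prop := ~ f v u v \/ f u v u.

Lemma edge_total u v : edge u v \/ edge v u.
Proof.
rewrite /edge; have [|] := pselect (f u v u); first by left; right.
by right; left.
Qed.

Lemma edge_refl u : edge u u.
Proof. by case: (edge_total u u). Qed.

(** If [v] in [B] is not a value of [f v u], then [u] is the only possible value; the selector must
    have one, and it lies in [B]. *)
Lemma edge_closed u v : edge u v -> B v -> B u.
Proof.
move=> uv Bv; have [_ [|_ fuvB]] := fB u v; first by exists v; split=> //; right.
case: uv => [Nv|/fuvB//].
have [fvu [|[w fw] fvuB]] := fB v u; first by exists v; split=> //; left.
by case: (fvu _ fw) => wE; [case: Nv; rewrite -{2}wE | rewrite -wE; apply: fvuB].
Qed.

Lemma definable_edge i j : definable (fun _ e => edge (e i) (e j)).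
Proof.
apply: (definable_or PNP); last exact: definable_output.
exact/definable_not/definable_output.
Qed.

Lemma definable_reaches2 k v : k != 5 -> v != 5 ->
  definable (fun n e => reaches2 edge n (e k) (e v)).
Proof.
move=> k5 v5; have vw := definable_edge v 5; have wk := definable_edge 5 k.
apply: definable_ext (@definable_ex PNP 5 _ isT (definable_and PNP vw wk)) => n e.
rewrite /upd eqxx (negPf k5) (negPf v5).
by split=> [[w wn [? ?]]|[w [wn ? ?]]]; exists w.
Qed.

(** Universal quantifiers and implications are rewritten as negated existentials, since
    [definable_ex] is the quantifier rule at hand. *)
Lemma definable_pred_closed :
  definable (fun n e => pred_closed edge n (reaches2 edge n (e 2))).
Proof.
have D4 := @definable_reaches2 2 4 isT isT.
have D3 := @definable_reaches2 2 3 isT isT.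
have H := definable_and PNP (definable_edge 3 4) (definable_and PNP D4 (definable_not D3)).
have := definable_not (@definable_ex PNP 3 _ isT (@definable_ex PNP 4 _ isT H)).
apply: definable_ext => n e; rewrite /upd /=.
split=> [N u v un vn uv Dv|cl [u un [v vn [uv [Dv]]]]]; last by apply; apply: cl uv Dv.
by apply: contrapT => Du; apply: N; exists u => //; exists v.
Qed.

Lemma definable_leE x y : x < 2 -> y < 2 ->
  definable (fun n e => leE edge n (e x) (e y)).
Proof.
move=> x2 y2.
have x25 : (x != 2) && (x != 5) by case: x x2 => [|[|]].
have y25 : (y != 2) && (y != 5) by case: y y2 => [|[|]].
case/andP: x25 y25 => xN2 xN5 /andP[yN2 yN5].
have Dx := @definable_reaches2 2 x isT xN5.
have Dy := @definable_reaches2 2 y isT yN5.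
have H := definable_and PNP definable_pred_closed (definable_and PNP Dy (definable_not Dx)).
have := definable_not (@definable_ex PNP 2 _ isT H).
apply: definable_ext => n e; rewrite /upd /= (negPf xN2) (negPf yN2).
split=> [N k kn kc ky|le [k kn [kc [ky]]]]; last by apply; apply: le.
by apply: contrapT => kx; apply: N; exists k.
Qed.

Lemma A_sel_FPt : A_sel FPt B.
Proof.
exists (choice_of (chooses edge)); split.
- have H := definable_and PNP (@definable_leE 0 1 isT isT)
    (definable_or PNP (definable_not (@definable_leE 1 0 isT isT))
                      (definable_size PNP 0 1)).
  exact: choice_of_FPt H _.
- move=> x y; rewrite /choice_of; split.
    by move=> _ ->; case: asboolP => _; [left|right].
  move=> [w [wxy Bw]]; split; first by eexists.
  set n := maxn (size x) (size y).
  have xn : size x <= n := leq_maxl _ _.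
  have yn : size y <= n := leq_maxr _ _.
  have Bcl : pred_closed edge n B by move=> u v _ _; apply: edge_closed.
  have xy := leE_closed edge_refl edge_total Bcl xn yn.
  have yx := leE_closed edge_refl edge_total Bcl yn xn.
  (* The chosen word precedes the other one at level [n], so as soon as either is in [B], closure
     under predecessors puts the chosen one there. *)
  move=> _ ->; case: asboolP => [[/xy lexy _]|Nch].
    by case: wxy Bw => ->.
  have [le _] : chooses edge y x by case: (chooses_total edge_total x y).
  rewrite maxnC in le.
  by case: wxy Bw => -> //; apply: yx.
- apply: choice_of_assoc => [x y|y x z]; first exact: chooses_total edge_total x y.
  exact: chooses_trans edge_refl edge_total y x z.
Qed.

End Selectors.

Theorem corollary7p3 :
  classP = classNP ->
  P_sel = A_P_sel /\
  sel FP = A_sel FP /\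
  NP_sel = A_NP_sel /\
  sel NPSV = A_sel NPSV /\
  sel NPMVt = A_sel NPMVt /\
  sel NPMV = A_sel NPMV.
Proof.
move=> PNP.
have FPNPMV : FP `<=` NPMV by move=> f [_ [M [_ Mp Mf]]]; exists M.
(* One inclusion forgets associativity; for the other, the selector is weakened to an NPMV one and
   the associative one found in [FPt] is carried back into [F]. *)
have eqF (F : set mvfun) : F `<=` NPMV -> FPt `<=` F -> sel F = A_sel F.
  move=> FN FF; apply/seteqP; split=> B [f]; last by move=> [Ff fB _]; exists f.
  move=> /FN fN fB; have [g [gF gB gA]] := A_sel_FPt PNP fN fB.
  by exists g; split=> //; apply: FF.
have FPNPSV : FP `<=` NPSV by move=> f Ff; split; [apply: FPNPMV | case: Ff].
split; first by apply: eqF => // f [/FPNPMV].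
split; first by apply: eqF => // f [].
split; first by apply: eqF => f [] => [[]|/FPNPSV].
split; first by apply: eqF => f [] // /FPNPSV.
split; first by apply: eqF => f [] // /FPNPMV.
by apply: eqF => // f [/FPNPMV].
Qed.
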